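(* Let $K$ be a field, $w=(w_1,\dots,w_k)$ a collection of positive integers, and $\xi_{ij}\in K^*$ for $1\le i\le k$, $1\le j\le w_i$. Then $A_{w,1,\xi}\cong e_0\Lambda^qe_0$ as $K$-algebras.
   Context: $A_{w,1,\xi}$ is the associative $K$-algebra with generators $x_1,\dots,x_k$ and relations $x_1x_2\cdots x_k=1$ and $(x_i-\xi_{i1}1)(x_i-\xi_{i2}1)\cdots(x_i-\xi_{i,w_i}1)=0$ for $i=1,\dots,k$. $Q_w$ is the star-shaped quiver with vertex set $I=\{0\}\cup\{[i,j]\mid1\le i\le k,\ 1\le j\le w_i-1\}$ and arrows $a_{ij}:[i,j]\to[i,j-1]$, where $[i,0]$ means $0$. $\overline{Q_w}$ is its double, obtained by adjoining a reverse arrow $a_{ij}^*:[i,j-1]\to[i,j]$ for each $a_{ij}$. Paths are composed from right to left (so $a_{ij}a_{ij}^*$ is a path from $[i,j-1]$ to itself). Let $q\in(K^* )^I$ be given by $q_0=\prod_{i=1}^k\xi_{i1}^{-1}$ and $q_{[i,j]}=\xi_{ij}/\xi_{i,j+1}$. The multiplicative preprojective algebra $\Lambda^q$ of Crawley-Boevey and Shaw is the algebra obtained from the path algebra $K\overline{Q_w}$ by universally inverting the elements $1+aa^*$ for all arrows $a$ of $\overline{Q_w}$ (with $a^{**}=a$) and imposing the relation $\prod_{a}(1+aa^* )^{\epsilon(a)}=\sum_{v\in I}q_ve_v$, where $a$ runs over the arrows of $\overline{Q_w}$, $\epsilon(a)=1$ for $a\in Q_w$, $\epsilon(a)=-1$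 for $a^*\in Q_w$, the product is taken in an order with $a_{11}<a_{21}<\dots<a_{k1}$, and $e_v$ is the trivial path at $v$. Explicitly: at the vertex $0$ the relation is $(e_0+a_{11}a_{11}^* )(e_0+a_{21}a_{21}^* )\cdots(e_0+a_{k1}a_{k1}^* )=q_0e_0$ (the $i$-th factor omitted if $w_i=1$), and at $[i,j]$ it is $e_{[i,j]}+a_{i,j+1}a_{i,j+1}^*=q_{[i,j]}\,(e_{[i,j]}+a_{ij}^*a_{ij})$, with the term $a_{i,j+1}a_{i,j+1}^*$ omitted when $j=w_i-1$. *)

(* Defs.v *)
From HB Require Import structures.
From mathcomp Require Import all_boot all_order all_algebra.
From mathcomp Require Import generic_quotient ring_quotient.
From mathcomp Require Import boolp finmap.
From mathcomp.multinomials Require Import monalg.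

Set Implicit Arguments.
Unset Strict Implicit.
Unset Printing Implicit Defensive.

Import GRing.Theory.
Local Open Scope ring_scope.
Local Open Scope quotient_scope.

(* K-algebras.  The zero algebra must be allowed (for instance k = 1, w_1 = 1,
   xi_11 <> 1 gives A_{w,1,xi} = 0), which excludes GRing.Algebra, whose
   carriers are nonzero.  A K-algebra is thus a pzRingType together with a ring
   morphism from K into its centre. *)
Record kalg (K : fieldType) := KAlg {
  kalg_ring :> pzRingType;
  kconst : {rmorphism K -> kalg_ring};
  kconst_central : forall c x, kconst c * x = x * kconst c
}.

Definition kalg_iso (K : fieldType) (A B : kalg K) : Prop :=
  exists f : {rmorphism A -> B},
    bijective f /\ (forall c, f (kconst A c) = kconst B c).

Section FreeAlgebra.
Variables (K : fieldType) (X : choiceType).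

Lemma malgC_central (c : K) (x : {malg K[{fmonom X}]}) :
  (c%:MP : {malg K[{fmonom X}]}) * x = x * c%:MP.
Proof.
rewrite mul_malgC malgM_def fgmulgU malgZ_def; apply/eq_bigr => k _.
by rewrite mulm1 mulrC.
Qed.

Definition free_alg : kalg K :=
  @KAlg K {malg K[{fmonom X}]} (@mkmalgU {fmonom X} K mone) malgC_central.

End FreeAlgebra.

HB.lock Definition free_gen (K : fieldType) (X : choiceType) (x : X)
  : free_alg K X := (<< fmu x >> : {malg K[{fmonom X}]}).
Canonical free_gen_unlockable := Unlockable free_gen.unlock.

Section Quotient.
Variables (K : fieldType) (A : kalg K) (P : A -> Prop).

(* Closure under opposite follows from closure under - 1 * _. *)
Definition two_sided_ideal (J : A -> Prop) : Prop :=
  [/\ J 0, (forall x y, J x -> J y -> J (x + y))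
    & (forall a x b, J x -> J (a * x * b))].

Definition generated_ideal (x : A) : Prop :=
  forall J : A -> Prop, two_sided_ideal J -> (forall y, P y -> J y) -> J x.

Definition in_ideal : pred A := fun x => `[< generated_ideal x >].

Lemma generated_ideal_two_sided : two_sided_ideal generated_ideal.
Proof.
split=> [J [J0 _ _] _ //|x y hx hy J hJ PJ|a x b hx J hJ PJ].
  by case: (hJ) => _ hD _; apply: hD; [exact: hx|exact: hy].
by case: (hJ) => _ _ hM; apply: hM; exact: hx.
Qed.

Lemma in_ideal_zmod_closed : zmod_closed in_ideal.
Proof.
have [h0 hD hM] := generated_ideal_two_sided.
split=> [|x y /asboolP hx /asboolP hy]; apply/asboolP => //.
by apply: hD => //; have := hM (- 1) y 1 hy; rewrite mulN1r mulr1.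
Qed.

HB.instance Definition _ := GRing.isZmodClosed.Build A in_ideal in_ideal_zmod_closed.

Definition in_ideal_zmod : zmodClosed A := GRing.ZmodClosed.clone A in_ideal _.

Definition quot_ring := Quotient.quot in_ideal_zmod.
HB.instance Definition _ := GRing.Zmodule.on quot_ring.
HB.instance Definition _ := EqQuotient.on quot_ring.

Local Notation pi := (\pi_quot_ring).

Lemma quot_eqP (x y : A) : pi x = pi y <-> generated_ideal (x - y).
Proof.
split=> [/eqP|h]; first by rewrite -Quotient.idealrBE => /asboolP.
by apply/eqP; rewrite -Quotient.idealrBE; apply/asboolP.
Qed.

Lemma quot_piD (x y : A) : pi (x + y) = pi x + pi y.
Proof. exact: Quotient.pi_add. Qed.

Definition quot_mul (x y : quot_ring) : quot_ring := pi (repr x * repr y).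

Lemma quot_piM (x y : A) : pi (x * y) = quot_mul (pi x) (pi y).
Proof.
apply/quot_eqP; have [_ hD hM] := generated_ideal_two_sided.
set x' := repr _; set y' := repr _.
have hx : generated_ideal (x - x') by apply/quot_eqP; rewrite reprK.
have hy : generated_ideal (y - y') by apply/quot_eqP; rewrite reprK.
have -> : x * y - x' * y' = (1 * (x - x') * y) + (x' * (y - y') * 1).
  by rewrite mul1r mulr1 mulrBl mulrBr addrA addrNK.
by apply: hD; apply: hM.
Qed.

Lemma quot_mulA : associative quot_mul.
Proof.
elim/quotW=> x; elim/quotW=> y; elim/quotW=> z.
by rewrite -(quot_piM y z) -(quot_piM x y) -!quot_piM mulrA.
Qed.
Lemma quot_mul1 : left_id (pi 1) quot_mul.
Proof. by elim/quotW=> x; rewrite -quot_piM mul1r. Qed.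
Lemma quot_1mul : right_id (pi 1) quot_mul.
Proof. by elim/quotW=> x; rewrite -quot_piM mulr1. Qed.
Lemma quot_mulDl : left_distributive quot_mul +%R.
Proof.
elim/quotW=> x; elim/quotW=> y; elim/quotW=> z.
by rewrite -(quot_piM x z) -(quot_piM y z) -!quot_piD -quot_piM mulrDl.
Qed.
Lemma quot_mulDr : right_distributive quot_mul +%R.
Proof.
elim/quotW=> x; elim/quotW=> y; elim/quotW=> z.
by rewrite -(quot_piM x y) -(quot_piM x z) -!quot_piD -quot_piM mulrDr.
Qed.

HB.instance Definition _ := GRing.Zmodule_isPzRing.Build quot_ring
  quot_mulA quot_mul1 quot_1mul quot_mulDl quot_mulDr.

Definition quot_proj (x : A) : quot_ring := pi x.

Lemma quot_proj_zmod_morphism : zmod_morphism quot_proj.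
Proof. exact: (pi_is_zmod_morphism (Quotient.quot in_ideal_zmod)). Qed.
Lemma quot_proj_monoid_morphism : monoid_morphism quot_proj.
Proof. by split=> [//|x y]; exact: quot_piM. Qed.

HB.instance Definition _ := GRing.isZmodMorphism.Build A quot_ring quot_proj
  quot_proj_zmod_morphism.
HB.instance Definition _ := GRing.isMonoidMorphism.Build A quot_ring quot_proj
  quot_proj_monoid_morphism.

Lemma quot_const_central (c : K) (x : quot_ring) :
  (quot_proj \o kconst A) c * x = x * (quot_proj \o kconst A) c.
Proof.
by elim/quotW: x => x; rewrite -/(quot_proj x) /= -!rmorphM kconst_central.
Qed.

Definition quot_alg : kalg K :=
  @KAlg K quot_ring (quot_proj \o kconst A) quot_const_central.

End Quotient.

(* Universal inversion of a family s of elements of A: adjoin to A free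
   generators y_i and impose s_i y_i = 1 = y_i s_i.  The algebra A<y_i> is
   presented by the generators inl x (x in A) and inr i, subject to the relations
   making x |-> inl x a morphism of K-algebras. *)
Section UniversalInversion.
Variables (K : fieldType) (A : kalg K) (I : choiceType) (s : I -> A).

Local Notation F := (free_alg K (A + I)%type).
Local Notation "[ x ]" := (free_gen K (inl x : (A + I)%type)).
Local Notation y i := (free_gen K (inr i : (A + I)%type)).

Inductive inversion_relation : F -> Prop :=
| InvRelD a b : inversion_relation ([a + b] - ([a] + [b]))
| InvRelM a b : inversion_relation ([a * b] - [a] * [b])
| InvRelC c : inversion_relation ([kconst A c] - kconst F c)
| InvRelV i : inversion_relation ([s i] * y i - 1)
| InvRelVr i : inversion_relation (y i * [s i] - 1).

Definition inverted_alg : kalg K := quot_alg inversion_relation.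

Definition inverted_in (x : A) : inverted_alg :=
  quot_proj inversion_relation [x].
Definition inverted_inv (i : I) : inverted_alg :=
  quot_proj inversion_relation (y i).

End UniversalInversion.

Section Corner.
Variables (K : fieldType) (A : kalg K) (e : A).

(* For an idempotent e this is the set e A e. *)
Definition corner_pred : pred A := fun x => x == e * x * e.

Lemma corner_zmod_closed : zmod_closed corner_pred.
Proof.
rewrite /corner_pred; split=> [|x y /eqP hx /eqP hy]; apply/eqP.
  by rewrite mulr0 mul0r.
by rewrite mulrBr mulrBl -hx -hy.
Qed.
HB.instance Definition _ := GRing.isZmodClosed.Build A corner_pred corner_zmod_closed.

Hypothesis ee : e * e = e.

Definition corner of e * e = e := {x : A | corner_pred x}.
Local Notation C := (corner ee).
HB.instance Definition _ := SubType.on C.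
HB.instance Definition _ := Choice.on C.
HB.instance Definition _ := [SubChoice_isSubZmodule of C by <:].

Lemma cornerl (x : C) : e * val x = val x.
Proof. by rewrite (eqP (valP x)) !mulrA ee. Qed.
Lemma cornerr (x : C) : val x * e = val x.
Proof. by rewrite (eqP (valP x)) -!mulrA ee. Qed.

Lemma corner_one_subproof : corner_pred e.
Proof. by rewrite /corner_pred !ee. Qed.
Lemma corner_mul_subproof (x y : C) : corner_pred (val x * val y).
Proof. by rewrite /corner_pred mulrA cornerl -mulrA cornerr. Qed.
Lemma corner_const_subproof (c : K) : corner_pred (kconst A c * e).
Proof. by rewrite /corner_pred mulrA -(kconst_central c e) -!mulrA !ee. Qed.

Definition corner_one : C := Sub e corner_one_subproof.
Definition corner_mul (x y : C) : C := Sub (val x * val y) (corner_mul_subproof x y).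
Definition corner_const (c : K) : C := Sub (kconst A c * e) (corner_const_subproof c).

Lemma corner_mulA : associative corner_mul.
Proof. by move=> x y z; apply/val_inj; rewrite /= mulrA. Qed.
Lemma corner_mul1 : left_id corner_one corner_mul.
Proof. by move=> x; apply/val_inj/cornerl. Qed.
Lemma corner_1mul : right_id corner_one corner_mul.
Proof. by move=> x; apply/val_inj/cornerr. Qed.
Lemma corner_mulDl : left_distributive corner_mul +%R.
Proof. by move=> x y z; apply/val_inj; rewrite /= mulrDl. Qed.
Lemma corner_mulDr : right_distributive corner_mul +%R.
Proof. by move=> x y z; apply/val_inj; rewrite /= mulrDr. Qed.

HB.instance Definition _ := GRing.Zmodule_isPzRing.Build C
  corner_mulA corner_mul1 corner_1mul corner_mulDl corner_mulDr.

Lemma corner_const_zmod_morphism : zmod_morphism corner_const.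
Proof. by move=> c d; apply/val_inj; rewrite /= rmorphB mulrBl. Qed.
Lemma corner_const_monoid_morphism : monoid_morphism corner_const.
Proof.
split=> [|c d]; apply/val_inj; rewrite /= ?rmorph1 ?mul1r //.
by rewrite rmorphM -!mulrA (kconst_central d e) (mulrA e e) ee.
Qed.
HB.instance Definition _ := GRing.isZmodMorphism.Build K C corner_const
  corner_const_zmod_morphism.
HB.instance Definition _ := GRing.isMonoidMorphism.Build K C corner_const
  corner_const_monoid_morphism.

Lemma corner_const_central (c : K) (x : C) :
  corner_const c * x = x * corner_const c.
Proof.
apply/val_inj; rewrite /= -mulrA cornerl mulrA -kconst_central.
by rewrite -mulrA cornerr.
Qed.

Definition corner_alg : kalg K := @KAlg K C corner_const corner_const_central.

End Corner.

Record quiver := Quiver {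
  vertex : finType;
  arrow : finType;
  src : arrow -> vertex;
  tgt : arrow -> vertex
}.

(* Paths compose from right to left: (v, [:: a_n; ...; a_1]) is the path
   a_n ... a_1 starting at v = src a_1; (v, [::]) is the trivial path e_v. *)
Section Paths.
Variable Q : quiver.

Definition word_end (v : vertex Q) (s : seq (arrow Q)) : vertex Q :=
  if s is a :: _ then tgt a else v.

Fixpoint is_path (v : vertex Q) (s : seq (arrow Q)) : bool :=
  if s is a :: s' then (src a == word_end v s') && is_path v s' else true.

Definition qpath := {p : vertex Q * seq (arrow Q) | is_path p.1 p.2}.
HB.instance Definition _ := SubType.on qpath.
HB.instance Definition _ := Choice.on qpath.

Definition path_src (p : qpath) : vertex Q := (val p).1.
Definition path_tgt (p : qpath) : vertex Q := word_end (val p).1 (val p).2.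

Lemma trivial_subproof (v : vertex Q) : is_path v [::].
Proof. by []. Qed.
Lemma arrow_subproof (a : arrow Q) : is_path (src a) [:: a].
Proof. by rewrite /= eqxx. Qed.

Definition trivial_path (v : vertex Q) :
  qpath := exist _ (v, [::]) (trivial_subproof v).
Definition arrow_path (a : arrow Q) :
  qpath := exist _ (src a, [:: a]) (arrow_subproof a).

(* When the test succeeds, the concatenation always is a path (comp_pathE), so
   insub does not discard anything. *)
Definition comp_path (p q : qpath) : option qpath :=
  if path_src p == path_tgt q
  then insub ((val q).1, (val p).2 ++ (val q).2) else None.

Lemma word_end_cat v s t : word_end v (s ++ t) = word_end (word_end v t) s.
Proof. by case: s. Qed.

Lemma is_path_cat v s t :
  is_path v (s ++ t) = is_path (word_end v t) s && is_path v t.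
Proof. by elim: s => //= a s ->; rewrite word_end_cat andbA. Qed.

Lemma comp_pathE p q : path_src p = path_tgt q ->
  exists2 r, comp_path p q = Some r
    & val r = ((val q).1, (val p).2 ++ (val q).2).
Proof.
move=> h; rewrite /comp_path h eqxx; case: insubP => /= [r _ <-|]; first by exists r.
by rewrite is_path_cat -[word_end _ _]h (valP p) (valP q).
Qed.

End Paths.

(* Locked, as failing unifications otherwise unfold basis elements and products. *)
HB.lock Definition path_elt (K : fieldType) (Q : quiver) (p : qpath Q)
  : {malg K[qpath Q]} := << p >>.
Canonical path_elt_unlockable := Unlockable path_elt.unlock.

Definition path_mul_basis (K : fieldType) (Q : quiver) (p q : qpath Q)
  : {malg K[qpath Q]} :=
  if comp_path p q is Some r then path_elt K r else 0.

HB.lock Definition path_mul (K : fieldType) (Q : quiver) (g h : {malg K[qpath Q]})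
  : {malg K[qpath Q]} :=
  \sum_(p <- msupp g) \sum_(q <- msupp h) (g@_p * h@_q) *: path_mul_basis K p q.
Canonical path_mul_unlockable := Unlockable path_mul.unlock.

Section PathAlgebra.
Variables (K : fieldType) (Q : quiver).
Local Notation P := (qpath Q).

Local Notation M := {malg K[P]}.
Local Notation path_elt := (@path_elt K Q).
Local Notation mulb := (@path_mul_basis K Q).
Local Notation path_mul := (@path_mul K Q).

Definition path_one : M := \sum_(v : vertex Q) path_elt (trivial_path v).

Lemma path_mulEw (d1 d2 : {fset P}) (g h : M) :
  (msupp g `<=` d1)%fset -> (msupp h `<=` d2)%fset ->
  path_mul g h = \sum_(p <- d1) \sum_(q <- d2) (g@_p * h@_q) *: mulb p q.
Proof.
move=> le1 le2; rewrite path_mul.unlock (big_fset_incl _ le1) /=.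
  apply/eq_bigr => p _; apply/big_fset_incl => // q _ /mcoeff_outdom ->.
  by rewrite mulr0 scale0r.
by move=> p _ /mcoeff_outdom h0; rewrite big1 // => q _; rewrite h0 mul0r scale0r.
Qed.

Lemma path_mulDl : left_distributive path_mul +%R.
Proof.
move=> g1 g2 h; have hh := fsubset_refl (msupp h).
rewrite (path_mulEw (msuppD_le g1 g2) hh).
rewrite (path_mulEw (fsubsetUl (msupp g1) (msupp g2)) hh).
rewrite (path_mulEw (fsubsetUr (msupp g1) (msupp g2)) hh) -big_split /=.
apply/eq_bigr => p _; rewrite -big_split /=; apply/eq_bigr => q _.
by rewrite mcoeffD mulrDl scalerDl.
Qed.

Lemma path_mulDr : right_distributive path_mul +%R.
Proof.
move=> g h1 h2; have hg := fsubset_refl (msupp g).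
rewrite (path_mulEw hg (msuppD_le h1 h2)).
rewrite (path_mulEw hg (fsubsetUl (msupp h1) (msupp h2))).
rewrite (path_mulEw hg (fsubsetUr (msupp h1) (msupp h2))) -big_split /=.
apply/eq_bigr => p _; rewrite -big_split /=; apply/eq_bigr => q _.
by rewrite mcoeffD mulrDr scalerDl.
Qed.

Lemma malgUZ (c : K) (p : P) : << c *g p >> = c *: path_elt p.
Proof.
apply/malgP => q; rewrite (mcoeffZ c (path_elt p) q).
rewrite path_elt.unlock; transitivity (c *+ (p == q)); first exact: mcoeffU.
transitivity (c * (1 *+ (p == q))).
  by case: (p == q); rewrite /= ?mulr1 ?mulr0.
by congr (c * _); symmetry; exact: mcoeffU.
Qed.

Lemma path_mulUU c d p q :
  path_mul << c *g p >> << d *g q >> = (c * d) *: mulb p q.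
Proof. by rewrite (path_mulEw msuppU_le msuppU_le) !big_seq_fset1 !mcoeffUU. Qed.

Lemma path_mul_elt p q : path_mul (path_elt p) (path_elt q) = mulb p q.
Proof.
rewrite path_elt.unlock; transitivity ((1 * 1 : K) *: mulb p q).
  exact: path_mulUU.
by rewrite mulr1 scale1r.
Qed.

Lemma path_mul0 h : path_mul 0 h = 0.
Proof. by apply: (addIr (path_mul 0 h)); rewrite -path_mulDl !add0r. Qed.
Lemma path_0mul g : path_mul g 0 = 0.
Proof. by apply: (addIr (path_mul g 0)); rewrite -path_mulDr !add0r. Qed.

Lemma path_mulZl c g h : path_mul (c *: g) h = c *: path_mul g h.
Proof.
rewrite (path_mulEw (msuppZ_le c g) (fsubset_refl _)).
rewrite path_mul.unlock scaler_sumr.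
apply/eq_bigr => p _; rewrite scaler_sumr; apply/eq_bigr => q _.
by rewrite (mcoeffZ c g) scalerA mulrA.
Qed.
Lemma path_mulZr c g h : path_mul g (c *: h) = c *: path_mul g h.
Proof.
rewrite (path_mulEw (fsubset_refl _) (msuppZ_le c h)).
rewrite path_mul.unlock scaler_sumr.
apply/eq_bigr => p _; rewrite scaler_sumr; apply/eq_bigr => q _.
by rewrite (mcoeffZ c h) scalerA mulrCA.
Qed.

Lemma comp_path_val (p q r : P) : comp_path p q = Some r ->
  [/\ path_src p = path_tgt q, path_src r = path_src q, path_tgt r = path_tgt p
    & (val r).2 = (val p).2 ++ (val q).2].
Proof.
rewrite {1}/comp_path; case: eqP => // h.
case: insubP => // r' _ hr [<-]; rewrite /path_src /path_tgt hr /=; split=> //.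
by rewrite word_end_cat -[word_end _ (val q).2]/(path_tgt q) -h.
Qed.

Lemma path_mul_basis_some (p q : P) : path_src p = path_tgt q ->
  exists r : P, [/\ mulb p q = path_elt r, path_src r = path_src q,
    path_tgt r = path_tgt p & (val r).2 = (val p).2 ++ (val q).2].
Proof.
move=> /comp_pathE[r hr _]; have [_ h1 h2 h3] := comp_path_val hr.
by exists r; rewrite /path_mul_basis hr.
Qed.

Lemma path_mul_basis_none (p q : P) : path_src p <> path_tgt q -> mulb p q = 0.
Proof. by move=> /eqP/negPf h; rewrite /path_mul_basis /comp_path h. Qed.

Lemma path_mulA1 (p q r : P) :
  path_mul (mulb p q) (path_elt r) = path_mul (path_elt p) (mulb q r).
Proof.
have [hpq|hpq] := eqVneq (path_src p) (path_tgt q);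
  have [hqr|hqr] := eqVneq (path_src q) (path_tgt r).
- have [u [-> us ut uw]] := path_mul_basis_some hpq.
  have [v [-> vs vt vw]] := path_mul_basis_some hqr.
  rewrite (path_mul_elt u r) (path_mul_elt p v).
  have [|x [-> xs _ xw]] := @path_mul_basis_some u r; first by rewrite us.
  have [|x' [-> xs' _ xw']] := @path_mul_basis_some p v; first by rewrite vt.
  congr path_elt; apply/val_inj.
  rewrite [LHS]surjective_pairing [RHS]surjective_pairing; congr pair.
    by rewrite -[LHS]/(path_src x) -[RHS]/(path_src x') xs xs' vs.
  by rewrite xw xw' uw vw catA.
- have [u [-> us _ _]] := path_mul_basis_some hpq.
  rewrite (path_mul_elt u r) (path_mul_basis_none (elimN eqP hqr)) path_0mul.
  by apply: path_mul_basis_none; rewrite us; apply/eqP.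
- have [v [-> _ vt _]] := path_mul_basis_some hqr.
  rewrite (path_mul_elt p v) (path_mul_basis_none (elimN eqP hpq)) path_mul0.
  by symmetry; apply: path_mul_basis_none; rewrite vt; apply/eqP.
- rewrite (path_mul_basis_none (elimN eqP hpq)) (path_mul_basis_none (elimN eqP hqr)).
  by rewrite path_mul0 path_0mul.
Qed.

Lemma path_ring_ind (Pr : M -> Prop) :
  Pr 0 -> (forall g h, Pr g -> Pr h -> Pr (g + h)) ->
  (forall c p, Pr (c *: path_elt p)) -> forall g, Pr g.
Proof.
move=> P0 PD PU g; rewrite (monalgE g); apply: big_ind => // p _.
by rewrite malgUZ.
Qed.

Lemma path_mulA : associative path_mul.
Proof.
move=> g h l; elim/path_ring_ind: g => [|g g' IH IH'|c p].
- by rewrite !path_mul0.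
- by rewrite (path_mulDl g g') IH IH' (path_mulDl g g') path_mulDl.
rewrite !path_mulZl; congr (_ *: _).
elim/path_ring_ind: h => [|h h' IH IH'|d q].
- by rewrite !(path_mul0, path_0mul).
- rewrite (path_mulDl h h' l) (path_mulDr _ h h').
  rewrite (path_mulDr _ (path_mul h l) (path_mul h' l)).
  rewrite IH IH'.
  by rewrite -path_mulDl.
apply: etrans (congr1 (path_mul (path_elt p)) (path_mulZl d (path_elt q) l)) _.
apply: etrans (path_mulZr d (path_elt p) _) _; apply: esym.
apply: etrans (congr1 (path_mul^~ l) (path_mulZr d (path_elt p) _)) _.
apply: etrans (path_mulZl d _ l) _; congr (_ *: _); apply: esym.
elim/path_ring_ind: l => [|l l' IH IH'|e r].
- by rewrite !path_0mul.
- rewrite (path_mulDr _ l l') (path_mulDr _ (path_mul _ l) (path_mul _ l')).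
  by rewrite IH IH' -path_mulDr.
apply: etrans (congr1 (path_mul (path_elt p)) (path_mulZr e _ (path_elt r))) _.
apply: etrans (path_mulZr e (path_elt p) _) _; apply: esym.
apply: etrans (path_mulZr e _ (path_elt r)) _; congr (_ *: _); apply: esym.
by rewrite (path_mul_elt q r) (path_mul_elt p q) path_mulA1.
Qed.

Lemma path_one_mull (p : P) : path_mul path_one (path_elt p) = path_elt p.
Proof.
have D : {morph path_mul^~ (path_elt p) : x y / x + y >-> x + y}.
  by move=> x y; exact: path_mulDl.
rewrite /path_one (big_morph _ D (path_mul0 _)) (bigD1 (path_tgt p)) //= big1.
  rewrite addr0 path_mul_elt /path_mul_basis.
  have [|r -> hr] := @comp_pathE Q (trivial_path (path_tgt p)) p; first by [].
  by congr path_elt; apply/val_inj; rewrite hr /= -surjective_pairing.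
by move=> v /eqP hv; rewrite path_mul_elt path_mul_basis_none.
Qed.

Lemma path_one_mulr (p : P) : path_mul (path_elt p) path_one = path_elt p.
Proof.
have D : {morph path_mul (path_elt p) : x y / x + y >-> x + y}.
  by move=> x y; exact: path_mulDr.
rewrite /path_one (big_morph _ D (path_0mul _)) (bigD1 (path_src p)) //= big1.
  rewrite addr0 path_mul_elt /path_mul_basis.
  have [|r -> hr] := @comp_pathE Q p (trivial_path (path_src p)); first by [].
  by congr path_elt; apply/val_inj; rewrite hr /= cats0 -surjective_pairing.
by move=> v /eqP hv; rewrite path_mul_elt path_mul_basis_none // => /esym.
Qed.

Lemma path_mul1g : left_id path_one path_mul.
Proof.
elim/path_ring_ind=> [|g h IH IH'|c p]; first exact: path_0mul.
  by rewrite path_mulDr IH IH'.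
by rewrite path_mulZr path_one_mull.
Qed.

Lemma path_mulg1 : right_id path_one path_mul.
Proof.
elim/path_ring_ind=> [|g h IH IH'|c p]; first exact: path_mul0.
  by rewrite path_mulDl IH IH'.
by rewrite path_mulZl path_one_mulr.
Qed.

Definition path_ring := M.
HB.instance Definition _ := GRing.Lmodule.on path_ring.
HB.instance Definition _ := GRing.Zmodule_isPzRing.Build path_ring
  path_mulA path_mul1g path_mulg1 path_mulDl path_mulDr.

Definition path_const (c : K) : path_ring := c *: path_one.

Lemma path_const_zmod_morphism : zmod_morphism path_const.
Proof. by move=> c d; exact: scalerBl. Qed.
Lemma path_const_monoid_morphism : monoid_morphism path_const.
Proof.
split=> [|c d]; first exact: scale1r.
apply: etrans (esym (scalerA c d path_one)) _; apply: esym.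
apply: etrans (path_mulZl c path_one (d *: path_one)) _.
by congr (c *: _); exact: path_mul1g.
Qed.
HB.instance Definition _ := GRing.isZmodMorphism.Build K path_ring path_const
  path_const_zmod_morphism.
HB.instance Definition _ := GRing.isMonoidMorphism.Build K path_ring path_const
  path_const_monoid_morphism.

Lemma path_const_central (c : K) (x : path_ring) :
  path_const c * x = x * path_const c.
Proof.
apply: etrans (path_mulZl c path_one x) (esym (etrans (path_mulZr c x path_one) _)).
by congr (c *: _); rewrite path_mul1g path_mulg1.
Qed.

Definition path_alg : kalg K := @KAlg K path_ring path_const path_const_central.

Definition path_vertex (v : vertex Q) : path_alg := path_elt (trivial_path v).
Definition path_arrow (a : arrow Q) : path_alg := path_elt (arrow_path a).

Lemma path_vertex_idem (v : vertex Q) : path_vertex v * path_vertex v = path_vertex v.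
Proof.
rewrite [LHS]path_mul_elt /path_mul_basis.
have [|r -> hr] := @comp_pathE Q (trivial_path v) (trivial_path v); first by [].
by congr path_elt; apply/val_inj; rewrite hr.
Qed.

End PathAlgebra.

(* In the double, inl a is the arrow a of Q and inr a is a^*. *)
Definition double_quiver (Q : quiver) : quiver :=
  @Quiver (vertex Q) (arrow Q + arrow Q)%type
    (fun b => match b with inl a => src a | inr a => tgt a end)
    (fun b => match b with inl a => tgt a | inr a => src a end).

Definition rev_arrow (Q : quiver) (b : arrow (double_quiver Q)) : arrow (double_quiver Q) :=
  match b with inl a => inr a | inr a => inl a end.

(* The multiplicative preprojective algebra, the product of the factors
   (1 + a a^* )^epsilon(a) being taken in the order of the sequence s, which is
   meant to enumerate the arrows of the double without repetition. *)
Section MultiplicativePreprojective.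
Variables (K : fieldType) (Q : quiver) (q : vertex Q -> K).
Variable s : seq (arrow (double_quiver Q)).

Local Notation KQ := (path_alg K (double_quiver Q)).

Definition mpa_elt (a : arrow (double_quiver Q)) : KQ :=
  1 + path_arrow K a * path_arrow K (rev_arrow a).

Definition mpa_loc : kalg K := inverted_alg mpa_elt.

Definition mpa_factor (a : arrow (double_quiver Q)) : mpa_loc :=
  match a with
  | inl _ => inverted_in mpa_elt (mpa_elt a)
  | inr _ => inverted_inv mpa_elt a
  end.

Definition mpa_weight : KQ :=
  \sum_(v : vertex Q) kconst KQ (q v) * path_vertex K (v : vertex (double_quiver Q)).

Inductive mpa_relation : mpa_loc -> Prop :=
| MpaRel : mpa_relation (\prod_(a <- s) mpa_factor a - inverted_in mpa_elt mpa_weight).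

Definition mpa : kalg K := quot_alg mpa_relation.

Definition mpa_vertex (v : vertex Q) : mpa :=
  quot_proj mpa_relation
    (inverted_in mpa_elt (path_vertex K (v : vertex (double_quiver Q)))).

Lemma mpa_vertex_idem v : mpa_vertex v * mpa_vertex v = mpa_vertex v.
Proof.
rewrite /mpa_vertex -rmorphM; congr (quot_proj _ _).
rewrite -[in RHS](path_vertex_idem K (v : vertex (double_quiver Q))).
rewrite /inverted_in -rmorphM; apply/esym/quot_eqP => J _; apply.
exact: InvRelM.
Qed.

End MultiplicativePreprojective.

Section StarShaped.
Variables (k : nat) (w : 'I_k -> nat).

(* For j : 'I_(w i).-1, the pair (i, j) stands for the index [i, j.+1], both as
   a vertex (Some) and as the arrow a_{i,j+1} : [i, j.+1] -> [i, j]. *)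
Definition arm_index := {i : 'I_k & 'I_(w i).-1}.

(* The vertex [i, j] for 0 <= j <= w_i - 1; None is the central vertex 0. *)
Definition star_vertex (i : 'I_k) (j : nat) : option arm_index :=
  if j is j'.+1
  then omap (fun l : 'I_(w i).-1 => Tagged (fun i => 'I_(w i).-1) l) (insub j')
  else None.

Definition star_quiver : quiver :=
  @Quiver (option arm_index) arm_index
    (fun a => Some a) (fun a => star_vertex (tag a) (tagged a)).

(* s lists the arrows of the double, with a_11 < a_21 < ... < a_k1. *)
Definition admissible_order (s : seq (arrow (double_quiver star_quiver))) : Prop :=
  [/\ uniq s, (forall a, a \in s)
    & forall a b : arm_index,
        tagged a = 0%N :> nat -> tagged b = 0%N :> nat -> (tag a < tag b)%N ->
        (index (inl a : arrow (double_quiver star_quiver)) s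
           < index (inl b : arrow (double_quiver star_quiver)) s)%N].

(* xi i j is xi_ij with j counted from 1; only 1 <= j <= w i is used. *)
Variables (K : fieldType) (xi : 'I_k -> nat -> K).

Definition star_weight (v : vertex star_quiver) : K :=
  if v is Some (existT i j) then xi i j.+1 / xi i j.+2
  else \prod_(i < k) (xi i 1%N)^-1.

Local Notation F := (free_alg K 'I_k).
Local Notation x i := (free_gen K i).

Inductive star_relation : F -> Prop :=
| StarRelProd : star_relation (\prod_(i < k) x i - 1)
| StarRelPoly i :
    star_relation (\prod_(1 <= j < (w i).+1) (x i - kconst F (xi i j))).

(* A_{w,1,xi} *)
Definition star_alg : kalg K := quot_alg star_relation.

End StarShaped.

(* Main.v *)
Require Import Defs.
From HB Require Import structures.
From mathcomp Require Import all_boot all_order all_algebra.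
From mathcomp Require Import generic_quotient ring_quotient.
From mathcomp Require Import boolp finmap.
From mathcomp Require Import zify.
From mathcomp.multinomials Require Import monalg.

Set Implicit Arguments.
Unset Strict Implicit.
Unset Printing Implicit Defensive.

Import GRing.Theory.
Local Open Scope ring_scope.
Local Open Scope quotient_scope.

(** Write A for the star algebra, L for the multiplicative preprojective
algebra, e for its idempotent at the central vertex, and [i,j] for the j-th
vertex of the i-th arm, so that a_ij : [i,j] -> [i,j-1].

At every vertex [i,j] put X_ij = xi_{i,j+1} (1 + a_{i,j+1} a_{i,j+1}^* ), where
the arrow that would leave the end of an arm counts as 0.  The relation of L at
[i,j] says that X_ij = xi_ij (1 + a_ij^* a_ij) there ([rel_arm]); hence X_{i,j-1}
a_ij = a_ij X_ij ([arm_gen_in]), and X_i0 slides along the path p_ij = a_i1 ...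
a_ij from [i,j] to the centre ([arm_gen_down]).  Since X_{i,j-1} - xi_ij = xi_ij
a_ij a_ij^*, the product of the X_i0 - xi_il for l <= j is a multiple of p_ij
followed backwards, and it vanishes for j = w_i, where p_ij = 0
([arm_gen_poly]).  The relation of L at the centre says that the X_i0 multiply
to e ([arm_gen_prod]).  So x_i |-> e X_i0 defines a morphism f : A -> e L e
([star_to_corner]).

It is onto because the sum over all vertices v of f(A) p_v, with p_v the path
above from v to the centre, is stable under right multiplication by L
([spanned_mul]): it suffices to multiply by generators, and
p_{i,j-1} (1 + a_ij a_ij^* ) = xi_ij^-1 X_i0 p_{i,j-1}.  The formal inverses cause
no trouble, as x_i is invertible in A: it is a root of a polynomial with nonzero
constant term ([linear_prod_unit]).  As this right ideal contains e, it is e L.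

It is injective because L acts on the direct sum over v of the right ideals
m_v A, with m_[i,j] the product of the x_i - xi_il for l <= j and m = 1 at the
centre: a_ij acts as the inclusion and a_ij^* as left multiplication by
xi_ij^-1 (x_i - xi_ij), so that f(a) acts on the central summand A as left
multiplication by a.  To keep clear of submodules, the action is realized as a
morphism psi from the localized path algebra to the square matrices over A
indexed by the vertices ([mx_repP], [loc_lift]).  The matrices whose rows lie in
the right ideals m_v A are stable under the image of psi ([in_armsP]), and the
elements whose image annihilates all of them form a two-sided ideal containing
the relation of L ([mpa_relation_killed]); the relation itself need not go to 0. *)

(** * Homomorphisms out of free algebras and quotients *)

Section Homs.
Variable (K : fieldType).
Implicit Types A B C : kalg K.

(** Morphisms of K-algebras. *)
Record khom A B := KHom {
  khom_fun :> {rmorphism A -> B};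
  khomC : forall c, khom_fun (kconst A c) = kconst B c
}.

Lemma khom_exists A B (f : A -> B) :
  zmod_morphism f -> (forall x y, f (x * y) = f x * f y) ->
  (forall c, f (kconst A c) = kconst B c) ->
  exists h : khom A B, h =1 f.
Proof.
move=> fB fM fC.
have f1 : monoid_morphism f.
  by split=> //; rewrite -(rmorph1 (kconst A)) fC rmorph1.
pose h : {rmorphism A -> B} := HB.pack f
  (GRing.isZmodMorphism.Build A B f fB) (GRing.isMonoidMorphism.Build A B f f1).
by exists (@KHom A B h fC).
Qed.

(** The predicate T is stable under the K-algebra operations; it contains 1 as
the image of 1 under the structure map. *)
Definition subalgebra A (T : A -> Prop) : Prop :=
  [/\ forall c, T (kconst A c), forall x y, T x -> T y -> T (x + y)
    & forall x y, T x -> T y -> T (x * y)].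

(** The subset G generates the K-algebra A, in the form of an induction
principle: a subalgebra containing G is everything. *)
Definition generates A (G : A -> Prop) : Prop :=
  forall T : A -> Prop, subalgebra T -> (forall x, G x -> T x) -> forall x, T x.

Lemma subalgebra_preim A B (f : khom A B) (T : B -> Prop) :
  subalgebra T -> subalgebra (fun x => T (f x)).
Proof.
by case=> TC TD TM; split=> [c|x y hx hy|x y hx hy];
  rewrite ?khomC ?rmorphD ?rmorphM; auto.
Qed.

Lemma malg_ind (P : choiceType) (T : {malg K[P]} -> Prop) :
  T 0 -> (forall g h, T g -> T h -> T (g + h)) ->
  (forall c p, T << c *g p >>) -> forall g, T g.
Proof.
by move=> T0 TD TU g; rewrite (monalgE g); apply: big_ind => // p _; apply: TU.
Qed.

Section MalgLift.
Variables (P : choiceType) (B : kalg K) (phi : P -> B).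

(** The K-linear extension to K[P] of a map phi defined on the basis P. *)
Definition malg_lift (g : {malg K[P]}) : B :=
  \sum_(p <- msupp g) kconst B g@_p * phi p.

Lemma malg_liftE (d : {fset P}) g : (msupp g `<=` d)%fset ->
  malg_lift g = \sum_(p <- d) kconst B g@_p * phi p.
Proof.
move=> le; rewrite /malg_lift (big_fset_incl _ le) //= => p _ /mcoeff_outdom ->.
by rewrite rmorph0 mul0r.
Qed.

Lemma malg_liftB : zmod_morphism malg_lift.
Proof.
move=> g h; rewrite (malg_liftE (msuppB_le g h)).
rewrite (malg_liftE (fsubsetUl (msupp g) (msupp h))).
rewrite (malg_liftE (fsubsetUr (msupp g) (msupp h))) -sumrB.
by apply: eq_bigr => p _; rewrite mcoeffB rmorphB mulrBl.
Qed.

Lemma malg_liftU c p : malg_lift << c *g p >> = kconst B c * phi p.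
Proof. by rewrite (malg_liftE msuppU_le) big_seq_fset1 mcoeffUU. Qed.

Lemma malg_lift0 : malg_lift 0 = 0.
Proof. by rewrite -(subrr 0) malg_liftB subrr. Qed.

Lemma malg_liftD : {morph malg_lift : g h / g + h}.
Proof.
move=> g h; have := malg_liftB (g + h) h; rewrite addrK => ->.
by rewrite subrK.
Qed.

Lemma malg_liftZ c g : malg_lift (c *: g) = kconst B c * malg_lift g.
Proof.
rewrite (malg_liftE (msuppZ_le c g)) /malg_lift mulr_sumr.
by apply: eq_bigr => p _; rewrite mcoeffZ rmorphM mulrA.
Qed.

(** A biadditive product on K[P] is respected by the linear extension of phi as
soon as it is respected on multiples of basis elements. The product is a
parameter because it varies: concatenation of words, composition of paths. *)
Lemma malg_liftM (mul : {malg K[P]} -> {malg K[P]} -> {malg K[P]}) :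
  left_distributive mul +%R -> right_distributive mul +%R ->
  (forall c d p q, malg_lift (mul << c *g p >> << d *g q >>)
     = malg_lift << c *g p >> * malg_lift << d *g q >>) ->
  forall g h, malg_lift (mul g h) = malg_lift g * malg_lift h.
Proof.
move=> mulDl mulDr mulU g h; elim/malg_ind: g => [|g g' IH IH'|c p].
- have -> : mul 0 h = 0 by apply: (addIr (mul 0 h)); rewrite -mulDl !add0r.
  by rewrite malg_lift0 mul0r.
- by rewrite mulDl malg_liftD IH IH' malg_liftD mulrDl.
elim/malg_ind: h => [|h h' IH IH'|d q]; last exact: mulU.
- set g := << _ *g _ >>.
  have -> : mul g 0 = 0 by apply: (addIr (mul g 0)); rewrite -mulDr !add0r.
  by rewrite malg_lift0 mulr0.
- by rewrite mulDr malg_liftD IH IH' malg_liftD mulrDr.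
Qed.

End MalgLift.

(** Universal property of the free algebra. *)
Lemma free_lift (X : choiceType) B (f : X -> B) :
  exists h : khom (free_alg K X) B, forall x, h (free_gen K x) = f x.
Proof.
pose phi (m : {fmonom X}) : B := \prod_(x <- (m : seq X)) f x.
have phiM (m n : {fmonom X}) : phi (mmul m n) = phi m * phi n.
  by rewrite /phi fmM big_cat.
have [||c|h hE] := @khom_exists (free_alg K X) B (malg_lift phi).
- exact: malg_liftB.
- apply: (malg_liftM (mul := fun x y : free_alg K X => x * y)).
  + exact: mulrDl.
  + exact: mulrDr.
  move=> c d m n; rewrite malgM_def fgmulUU !malg_liftU phiM rmorphM -!mulrA.
  by congr (_ * _); rewrite !mulrA kconst_central.
- by rewrite [LHS]malg_liftU /phi fm1 big_nil mulr1.
exists h => x; rewrite hE free_gen.unlock malg_liftU /phi fmU big_seq1.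
by rewrite rmorph1 mul1r.
Qed.

Lemma free_generates (X : choiceType) :
  generates (fun y : free_alg K X => exists x, y = free_gen K x).
Proof.
move=> T [TC TD TM] TG; elim/malg_ind => [||c m].
- by rewrite -[0](rmorph0 (kconst (free_alg K X))).
- exact: TD.
have -> : << c *g m >> = kconst (free_alg K X) c
    * \prod_(x <- (m : seq X)) free_gen K x.
  have -> : \prod_(x <- (m : seq X)) free_gen K x = << m >> :> free_alg K X.
    case: m; elim => [|x l IH].
      by rewrite big_nil -fmoneE.
    rewrite big_cons IH free_gen.unlock [LHS]malgM_def fgmulUU mulr1.
    by congr << _ >>; apply/val_inj; rewrite /= fmM fmU.
  by rewrite [RHS]malgM_def fgmulUU mulr1 mul1m.
apply: (TM); first exact: TC.
apply: big_ind => [||x _]; last by apply: TG; exists x.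
  by rewrite -(rmorph1 (kconst (free_alg K X))).
exact: TM.
Qed.

Lemma quot_proj_surj A (P : A -> Prop) (y : quot_alg P) :
  exists x, y = quot_proj P x.
Proof. by elim/quotW: y => x; exists x. Qed.

(** Universal property of the quotient by a generated two-sided ideal. *)
Lemma quot_lift A B (P : A -> Prop) (f : khom A B) :
  (forall x, P x -> f x = 0) ->
  exists h : khom (quot_alg P) B, forall x, h (quot_proj P x) = f x.
Proof.
move=> fP; pose g (y : quot_alg P) : B := f (repr (y : quot_ring P)).
have gE x : g (quot_proj P x) = f x.
  apply/eqP; rewrite -subr_eq0 -rmorphB; apply/eqP.
  have /quot_eqP : \pi_(quot_ring P) (repr (quot_proj P x)) = \pi x.
    by rewrite reprK.
  move=> /(_ (fun z => f z = 0)); apply=> //.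
  split=> [|y z hy hz|a y b hy]; first exact: rmorph0.
    by rewrite rmorphD hy hz addr0.
  by rewrite !rmorphM hy mulr0 mul0r.
have [||c|h hE] := @khom_exists (quot_alg P) B g.
- move=> x y; have [x' ->] := quot_proj_surj x; have [y' ->] := quot_proj_surj y.
  by rewrite -rmorphB !gE rmorphB.
- move=> x y; have [x' ->] := quot_proj_surj x; have [y' ->] := quot_proj_surj y.
  by rewrite -rmorphM !gE rmorphM.
- by rewrite [kconst _ c]/= gE khomC.
by exists h => x; rewrite hE gE.
Qed.

Lemma quot_proj0 A (P : A -> Prop) x : P x -> quot_proj P x = 0.
Proof.
move=> hx; rewrite -[0](rmorph0 (quot_proj P)); apply/quot_eqP => J _; apply.
by rewrite subr0.
Qed.

Lemma quot_generates A (P G : A -> Prop) : generates G ->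
  generates (fun y : quot_alg P => exists2 x, G x & y = quot_proj P x).
Proof.
move=> gen T [TC TD TM] TG y; have [x ->] := quot_proj_surj y.
move: x; apply: gen => [|x Gx]; last by apply: TG; exists x.
split=> [c|x x' hx hx'|x x' hx hx']; first exact: TC.
  by rewrite rmorphD; apply: TD.
by rewrite rmorphM; apply: TM.
Qed.

End Homs.

(** * Homomorphisms out of localizations and path algebras *)

Section Inversion.
Variables (K : fieldType) (A : kalg K) (I : choiceType) (s : I -> A).
Local Notation R := (@inversion_relation K A I s).

Lemma inverted_in_khom :
  exists h : khom A (inverted_alg s), h =1 inverted_in s.
Proof.
have hD a b : inverted_in s (a + b) = inverted_in s a + inverted_in s b.
  rewrite /inverted_in -rmorphD; apply/eqP; rewrite -subr_eq0 -rmorphB.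
  by apply/eqP/quot_proj0; exact: InvRelD.
apply: khom_exists => [a b|a b|c].
- by have := hD (a - b) b; rewrite subrK => ->; rewrite addrK.
- rewrite /inverted_in -rmorphM; apply/eqP; rewrite -subr_eq0 -rmorphB.
  by apply/eqP/quot_proj0; exact: InvRelM.
rewrite /inverted_in /=; apply/eqP; rewrite -subr_eq0 -rmorphB.
by apply/eqP/quot_proj0; exact: InvRelC.
Qed.

Lemma inverted_mulV i : inverted_in s (s i) * inverted_inv s i = 1.
Proof.
rewrite /inverted_in /inverted_inv -rmorphM.
apply/eqP; rewrite -subr_eq0 -[1](rmorph1 (quot_proj R)) -rmorphB.
by apply/eqP/quot_proj0; exact: InvRelV.
Qed.

Lemma inverted_mulVr i : inverted_inv s i * inverted_in s (s i) = 1.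
Proof.
rewrite /inverted_in /inverted_inv -rmorphM.
apply/eqP; rewrite -subr_eq0 -[1](rmorph1 (quot_proj R)) -rmorphB.
by apply/eqP/quot_proj0; exact: InvRelVr.
Qed.

(** Universal property of the algebra in which the elements s i are inverted. *)
Lemma inverted_lift B (f : khom A B) (t : I -> B) :
  (forall i, f (s i) * t i = 1) -> (forall i, t i * f (s i) = 1) ->
  exists h : khom (inverted_alg s) B,
    (forall x, h (inverted_in s x) = f x) /\ (forall i, h (inverted_inv s i) = t i).
Proof.
move=> ft tf.
pose g (z : A + I) : B := match z with inl x => f x | inr i => t i end.
have [h hE] := free_lift g.
have [|h' h'E] := @quot_lift K _ _ R h.
  move=> _ [a b|a b|c|i|i]; rewrite rmorphB.
  - by rewrite rmorphD !hE /= rmorphD subrr.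
  - by rewrite rmorphM !hE /= rmorphM subrr.
  - by rewrite hE /= !khomC subrr.
  - by rewrite rmorphM !hE rmorph1 /= ft subrr.
  - by rewrite rmorphM !hE rmorph1 /= tf subrr.
by exists h'; split=> z; rewrite h'E hE.
Qed.

Lemma inverted_generates (G : A -> Prop) : generates G ->
  generates (fun y : inverted_alg s =>
    (exists2 x, G x & y = inverted_in s x) \/ (exists i, y = inverted_inv s i)).
Proof.
move=> gen T subT TG; apply: (quot_generates (@free_generates K _)) => // y.
move=> [_ [[x|i] ->] ->]; last by apply: TG; right; exists i.
rewrite -/(inverted_in s x); have [h hE] := inverted_in_khom.
rewrite -hE; move: x; apply: gen => [|x Gx]; first exact: subalgebra_preim.
by rewrite hE; apply: TG; left; exists x.
Qed.

End Inversion.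

(** A complete family of orthogonal idempotents, some of which may be 0. *)
Record vertex_system (K : fieldType) (V : finType) (B : kalg K) (E : V -> B)
  : Prop := VertexSystem {
  vs_idem : forall v, E v * E v = E v;
  vs_orth : forall u v, u != v -> E u * E v = 0;
  vs_sum : \sum_v E v = 1
}.

Section PathLift.
Variables (K : fieldType) (Q : quiver).

Local Notation pelt p := (path_elt K p : path_alg K Q).

Lemma path_mulE (p q : qpath Q) : pelt p * pelt q = path_mul_basis K p q.
Proof. exact: path_mul_elt. Qed.

Lemma path_vertex_system : vertex_system (fun v : vertex Q => path_vertex K v).
Proof.
split=> [v|u v /eqP uv|//]; first exact: path_vertex_idem.
by rewrite [LHS]path_mulE path_mul_basis_none.
Qed.

Lemma path_mul_concat (p q r : qpath Q) : path_src p = path_tgt q ->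
  path_src r = path_src q -> (val r).2 = (val p).2 ++ (val q).2 ->
  pelt p * pelt q = pelt r.
Proof.
move=> pq rs rw; rewrite [LHS]path_mulE.
have [r' [-> h1 _ h2]] := @path_mul_basis_some K Q p q pq.
congr path_elt; apply/val_inj; rewrite [LHS]surjective_pairing.
rewrite [RHS]surjective_pairing h2 rw; congr (_, _).
by rewrite -/(path_src r') -/(path_src r) h1.
Qed.

Lemma path_arrow_tgt (a : arrow Q) :
  path_vertex K (tgt a) * path_arrow K a = path_arrow K a.
Proof. exact: path_mul_concat. Qed.

Lemma path_arrow_src (a : arrow Q) :
  path_arrow K a * path_vertex K (src a) = path_arrow K a.
Proof. exact: path_mul_concat. Qed.

Lemma path_generates : generates (fun x : path_alg K Q =>
  (exists v, x = path_vertex K v) \/ (exists a, x = path_arrow K a)).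
Proof.
move=> T [TC TD TM] TG; apply: path_ring_ind => [||c p].
- by rewrite -[0](rmorph0 (kconst (path_alg K Q))).
- exact: TD.
have -> : c *: path_elt K p = kconst (path_alg K Q) c * pelt p.
  apply: etrans (esym (path_mulZl c (path_one K Q) (path_elt K p))).
  by rewrite path_one_mull.
apply: (TM); first exact: TC.
case: p => [[v l] hp]; elim: l hp => [|a l IH] hp.
  apply: TG; left; exists v; congr path_elt; exact: val_inj.
have /= /andP[/eqP sa hl] := hp.
set r : qpath Q := exist _ (v, l) hl.
rewrite -(@path_mul_concat (arrow_path a) r) //.
by apply: TM; [apply: TG; right; exists a|exact: IH].
Qed.

(** Universal property of the path algebra. A path whose word is a_n ... a_1 and
whose source is v is sent to al a_n ... al a_1 E v, so that trivial paths are
covered too. *)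
Lemma path_lift (B : kalg K) (E : vertex Q -> B) (al : arrow Q -> B) :
  vertex_system E -> (forall a, E (tgt a) * al a = al a) ->
  (forall a, al a * E (src a) = al a) ->
  exists h : khom (path_alg K Q) B,
    (forall v, h (path_vertex K v) = E v) /\ (forall a, h (path_arrow K a) = al a).
Proof.
move=> [EE Eo Es] alt als.
pose phi (p : qpath Q) : B := \prod_(a <- (val p).2) al a * E (val p).1.
have phit p : E (path_tgt p) * phi p = phi p.
  rewrite /phi /path_tgt; case: (val p) => v [|a l] /=.
    by rewrite big_nil mul1r EE.
  by rewrite big_cons !mulrA alt.
have phiE p : phi p = \prod_(a <- (val p).2) al a * E (val p).1 by [].
(* from here on phi is only known through phiE *)
clearbody phi.
have phiU p : malg_lift phi (path_elt K p) = phi p.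
  by rewrite path_elt.unlock malg_liftU rmorph1 mul1r.
have phiM p q : malg_lift phi (path_mul_basis K p q) = phi p * phi q.
  have [pq|/eqP pq] := eqVneq (path_src p) (path_tgt q).
    have [r [-> h1 _ h2]] := @path_mul_basis_some K Q p q pq.
    rewrite phiU; transitivity (\prod_(a <- (val p).2) al a * phi q).
      by rewrite !phiE h2 big_cat -mulrA; congr (_ * (_ * E _)).
    by rewrite -{1}[phi q]phit -pq mulrA [phi p]phiE.
  rewrite path_mul_basis_none // malg_lift0 -[phi q]phit phiE -!mulrA.
  by rewrite [E _ * (E _ * _)]mulrA Eo ?mul0r ?mulr0 //; apply/eqP.
have [||c|h hE] := @khom_exists K (path_alg K Q) B (malg_lift phi).
- exact: malg_liftB.
- apply: (malg_liftM (mul := @path_mul K Q)).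
  + exact: path_mulDl.
  + exact: path_mulDr.
  move=> c d p q; apply: etrans (congr1 (malg_lift phi) (path_mulUU c d p q)) _.
  apply: etrans (malg_liftZ phi (c * d) _) _; rewrite (phiM p q).
  apply/esym.
  apply: etrans (congr2 *%R (malg_liftU phi c p) (malg_liftU phi d q)) _.
  apply/esym.
  rewrite (rmorphM (kconst B) c d) -!mulrA; congr (_ * _).
  by rewrite !mulrA kconst_central.
- rewrite [kconst _ c]/= /path_const.
  apply: etrans (malg_liftZ phi c _) _; rewrite /path_one.
  rewrite (big_morph _ (malg_liftD phi) (malg_lift0 phi)).
  rewrite (eq_bigr E) ?Es ?mulr1 // => v _.
  by rewrite phiU phiE big_nil mul1r.
exists h; split=> [v|a]; rewrite hE phiU phiE /=.
  by rewrite big_nil mul1r.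
by rewrite big_seq1 als.
Qed.

End PathLift.

(** * Multiplicative preprojective algebras *)

(** If e commutes with all factors and absorbs those outside P, only the
factors in P matter in e times an ordered product. *)
Lemma prod_mul_local (R : pzRingType) (I : Type) (e : R) (F : I -> R)
    (P : pred I) (s : seq I) :
  (forall a, e * F a = F a * e) -> (forall a, ~~ P a -> e * F a = e) ->
  e * \prod_(a <- s) F a = e * \prod_(a <- s | P a) F a.
Proof.
move=> eF eP; elim: s => [|a s IH]; first by rewrite !big_nil.
rewrite !big_cons; case: ifPn => [_|/eP eFa]; last by rewrite mulrA eFa.
by rewrite !mulrA !eF -!mulrA IH.
Qed.

Lemma vertex_system_weight (K : fieldType) (V : finType) (B : kalg K)
    (E : V -> B) (q : V -> K) v : vertex_system E ->
  E v * \sum_u kconst B (q u) * E u = kconst B (q v) * E v.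
Proof.
case=> [vE vO _]; rewrite mulr_sumr (bigD1 v) //= big1 => [|u uv].
  by rewrite addr0 mulrA -kconst_central -mulrA vE.
by rewrite mulrA -kconst_central -mulrA vO ?mulr0 // eq_sym.
Qed.

Section Representations.
Variables (K : fieldType) (Q : quiver).
Local Notation D := (double_quiver Q).

(** A representation, in a K-algebra B, of the path algebra of the double of Q
with the elements 1 + a a^* inverted: idempotents E v, arrows al a and inverses
inv a. *)
Record mpa_loc_rep (B : kalg K) (E : vertex Q -> B) (al inv : arrow D -> B) : Prop :=
  MpaLocRep {
    rep_vertices : vertex_system E;
    rep_tgt : forall a : arrow D, E (tgt a) * al a = al a;
    rep_src : forall a : arrow D, al a * E (src a) = al a;
    rep_mulV : forall a, (1 + al a * al (rev_arrow a)) * inv a = 1;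
    rep_Vmul : forall a, inv a * (1 + al a * al (rev_arrow a)) = 1
  }.

(** The factor (1 + a a^* )^epsilon(a) attached to an arrow of the double. *)
Definition rep_factor (B : kalg K) (al inv : arrow D -> B) (a : arrow D) : B :=
  match a with
  | inl _ => 1 + al a * al (rev_arrow a)
  | inr _ => inv a
  end.

Definition loc_vertex (v : vertex Q) : mpa_loc K Q :=
  inverted_in (@mpa_elt K Q) (path_vertex K (v : vertex D)).
Definition loc_arrow (a : arrow D) : mpa_loc K Q :=
  inverted_in (@mpa_elt K Q) (path_arrow K a).
Definition loc_inv (a : arrow D) : mpa_loc K Q :=
  inverted_inv (@mpa_elt K Q) a.

Lemma loc_repP : mpa_loc_rep loc_vertex loc_arrow loc_inv.
Proof.
have [h hE] := inverted_in_khom (@mpa_elt K Q).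
have eltE a : 1 + loc_arrow a * loc_arrow (rev_arrow a)
    = inverted_in (@mpa_elt K Q) (mpa_elt K a).
  by rewrite /loc_arrow -!hE /mpa_elt rmorphD rmorph1 rmorphM.
have [vE vO vS] := path_vertex_system K D.
split.
- split=> [v|u v uv|].
  + by rewrite /loc_vertex -!hE -rmorphM vE.
  + by rewrite /loc_vertex -!hE -rmorphM vO // rmorph0.
  + rewrite -(rmorph1 h) -vS rmorph_sum; apply: eq_bigr => v _.
    by rewrite hE.
- by move=> a; rewrite /loc_vertex /loc_arrow -!hE -rmorphM path_arrow_tgt.
- by move=> a; rewrite /loc_vertex /loc_arrow -!hE -rmorphM path_arrow_src.
- by move=> a; rewrite eltE inverted_mulV.
- by move=> a; rewrite eltE inverted_mulVr.
Qed.

Lemma loc_generates (T : mpa_loc K Q -> Prop) : subalgebra T ->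
  (forall v, T (loc_vertex v)) -> (forall a, T (loc_arrow a)) ->
  (forall a, T (loc_inv a)) -> forall x, T x.
Proof.
move=> subT Tv Ta Ti; apply: (inverted_generates (@path_generates K D)) => //.
by move=> y [[_ [[v ->]|[a ->]] ->]|[a ->]]; [exact: Tv|exact: Ta|exact: Ti].
Qed.

Lemma loc_lift (B : kalg K) E al inv : @mpa_loc_rep B E al inv ->
  exists h : khom (mpa_loc K Q) B,
    [/\ forall v, h (loc_vertex v) = E v, forall a, h (loc_arrow a) = al a
      & forall a, h (loc_inv a) = inv a].
Proof.
case=> vs ht hs hV Vh; have [f [fv fa]] := @path_lift K D B E al vs ht hs.
have fE a : f (mpa_elt K a) = 1 + al a * al (rev_arrow a).
  by rewrite rmorphD rmorph1 rmorphM !fa.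
have [|a|h [h1 h2]] := @inverted_lift K _ _ (@mpa_elt K Q) B f inv.
- by move=> a; rewrite fE hV.
- by rewrite fE Vh.
by exists h; split=> [v|a|a]; rewrite ?h1 ?h2.
Qed.

Lemma khom_rep (B C : kalg K) (h : khom B C) E al inv : @mpa_loc_rep B E al inv ->
  @mpa_loc_rep C (h \o E) (h \o al) (h \o inv).
Proof.
have h1 : h 1 = 1 by exact: rmorph1.
case=> [[vE vO vS] ht hs hV Vh]; split=> [|a|a|a|a] /=.
- split=> [v|u v uv|] /=.
  + by rewrite -rmorphM vE.
  + by rewrite -rmorphM vO // rmorph0.
  + by rewrite -h1 -vS rmorph_sum.
- by rewrite -rmorphM ht.
- by rewrite -rmorphM hs.
- by rewrite -h1 -!rmorphM -rmorphD -rmorphM hV.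
- by rewrite -h1 -!rmorphM -rmorphD -rmorphM Vh.
Qed.

Section Factors.
Variables (B : kalg K) (E : vertex Q -> B) (al inv : arrow D -> B).
Hypothesis rep : mpa_loc_rep E al inv.

Lemma rep_vertex_loop (a : arrow D) v :
  E v * (al a * al (rev_arrow a))
    = if tgt a == v then al a * al (rev_arrow a) else 0.
Proof.
have [[vE vO _] ht _ _ _] := rep.
case: eqVneq => [<-|hv]; first by rewrite mulrA ht.
by rewrite -(ht a) !mulrA vO ?mul0r // eq_sym.
Qed.

Lemma rep_loop_vertex (a : arrow D) v :
  al a * al (rev_arrow a) * E v
    = if tgt a == v then al a * al (rev_arrow a) else 0.
Proof.
have [[vE vO _] _ hs _ _] := rep.
have sr : src (rev_arrow a) = tgt a by case: (a).
case: eqVneq => [<-|hv]; first by rewrite -mulrA -sr hs.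
by rewrite -(hs (rev_arrow a)) sr -!mulrA vO ?mulr0.
Qed.

Lemma rep_vertex_gunit (a : arrow D) v :
  E v * (1 + al a * al (rev_arrow a)) = (1 + al a * al (rev_arrow a)) * E v.
Proof. by rewrite mulrDr mulrDl mulr1 mul1r rep_vertex_loop rep_loop_vertex. Qed.

Lemma rep_vertex_inv (a : arrow D) v : E v * inv a = inv a * E v.
Proof.
have [_ _ _ hV Vh] := rep.
rewrite -[LHS]mul1r -(Vh a) -[LHS]mulrA [X in _ * X]mulrA -rep_vertex_gunit.
by rewrite -!mulrA hV mulr1.
Qed.

Lemma rep_vertex_inv1 (a : arrow D) v : tgt a != v -> E v * inv a = E v.
Proof.
have [_ _ _ hV _] := rep.
move=> hv; rewrite -[RHS]mulr1 -(hV a) [RHS]mulrA mulrDr mulr1.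
by rewrite rep_vertex_loop (negPf hv) addr0.
Qed.

(** Seen from the vertex v, the ordered product defining the relation only
involves the arrows with target v. *)
Lemma rep_vertex_prod (s : seq (arrow D)) v :
  E v * \prod_(a <- s) rep_factor al inv a
    = E v * \prod_(a <- s | tgt a == v) rep_factor al inv a.
Proof.
apply: prod_mul_local => [[a|a]|[a|a] hv] /=.
- exact: rep_vertex_gunit.
- exact: rep_vertex_inv.
- by rewrite mulrDr mulr1 (rep_vertex_loop (inl a)) (negPf hv) addr0.
- exact: rep_vertex_inv1.
Qed.

End Factors.

Variables (q : vertex Q -> K) (s : seq (arrow D)).

Definition mpa_arrow (a : arrow D) : mpa q s :=
  quot_proj (mpa_relation q s) (loc_arrow a).
Definition mpa_inv (a : arrow D) : mpa q s :=
  quot_proj (mpa_relation q s) (loc_inv a).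

Lemma quot_khom (A : kalg K) (P : A -> Prop) :
  exists h : khom A (@quot_alg K A P), h =1 quot_proj P.
Proof.
apply: khom_exists => [x y|x y|//]; [exact: rmorphB|exact: rmorphM].
Qed.

Lemma mpa_repP : mpa_loc_rep (mpa_vertex q s) mpa_arrow mpa_inv.
Proof.
have [h hE] := quot_khom (mpa_relation q s).
have := khom_rep h loc_repP.
have -> : h \o loc_vertex = mpa_vertex q s by apply/funext => v; rewrite /= hE.
have -> : h \o loc_arrow = mpa_arrow by apply/funext => v; rewrite /= hE.
by have -> : h \o loc_inv = mpa_inv by apply/funext => v; rewrite /= hE.
Qed.

Lemma loc_factorE a : mpa_factor K a = rep_factor loc_arrow loc_inv a.
Proof.
have [h hE] := inverted_in_khom (@mpa_elt K Q).
case: a => // a; rewrite /mpa_factor /rep_factor.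
by rewrite /loc_arrow -!hE /mpa_elt rmorphD rmorph1 rmorphM.
Qed.

Lemma loc_weightE : inverted_in (@mpa_elt K Q) (mpa_weight q)
  = \sum_v kconst (mpa_loc K Q) (q v) * loc_vertex v.
Proof.
have [h hE] := inverted_in_khom (@mpa_elt K Q).
rewrite -hE rmorph_sum; apply: eq_bigr => v _.
by rewrite rmorphM khomC hE.
Qed.

Lemma mpa_prodE : \prod_(a <- s) rep_factor mpa_arrow mpa_inv a
  = \sum_v kconst (mpa q s) (q v) * mpa_vertex q s v.
Proof.
have /quot_proj0 := MpaRel q s; rewrite loc_weightE rmorphB => /subr0_eq.
rewrite rmorph_prod => e; apply: etrans (etrans e _).
  apply: eq_bigr => a _; rewrite loc_factorE.
  by case: a => // a; rewrite /rep_factor rmorphD rmorph1 rmorphM.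
by rewrite rmorph_sum; apply: eq_bigr => v _; rewrite rmorphM.
Qed.

Lemma mpa_generates (T : mpa q s -> Prop) : subalgebra T ->
  (forall v, T (mpa_vertex q s v)) -> (forall a, T (mpa_arrow a)) ->
  (forall a, T (mpa_inv a)) -> forall x, T x.
Proof.
move=> subT Tv Ta Ti x; have [y ->] := quot_proj_surj x.
have [h hE] := quot_khom (mpa_relation q s).
rewrite -hE; move: y.
apply: loc_generates => [|v|a|a]; rewrite ?hE; first exact: subalgebra_preim.
- exact: Tv.
- exact: Ta.
- exact: Ti.
Qed.

(** The defining relation of the multiplicative preprojective algebra, localized
at the vertex v. *)
Lemma mpa_vertex_prod v : mpa_vertex q s v
    * \prod_(a <- s | tgt a == v) rep_factor mpa_arrow mpa_inv a
  = kconst (mpa q s) (q v) * mpa_vertex q s v.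
Proof.
rewrite -(rep_vertex_prod mpa_repP) mpa_prodE.
exact: (vertex_system_weight q v (rep_vertices mpa_repP)).
Qed.

End Representations.

(** * Ordered products along a star-shaped quiver *)

Section StarOrder.
Variables (k : nat) (w : 'I_k -> nat).
Local Notation Q := (star_quiver w).
Local Notation D := (double_quiver Q).
Local Notation arm := (arm_index w).

(** The index [i, j.+1], standing both for a vertex and for the arrow
[i, j.+1] -> [i, j]; None if the arm i is too short. *)
Definition arm_at (i : 'I_k) (j : nat) : option arm :=
  omap (fun l : 'I_(w i).-1 => Tagged (fun i => 'I_(w i).-1) l) (insub j).

Lemma arm_eq (a b : arm) :
  (a == b) = (tag a == tag b) && (tagged a == tagged b :> nat).
Proof.
case: a b => [i l] [i' l'] /=; case: (i =P i') => [e|ne] /=; last first.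
  by apply/negbTE/eqP => e; apply: ne; case: e.
by subst i'; rewrite -tag_eqE /tag_eq /= eqxx tagged_asE.
Qed.

Variant arm_at_spec (i : 'I_k) (j : nat) : option arm -> Type :=
| ArmAtSome (a : arm) of tag a = i & tagged a = j :> nat & (j < (w i).-1)%N :
    arm_at_spec i j (Some a)
| ArmAtNone of ((w i).-1 <= j)%N : arm_at_spec i j None.

Lemma arm_atP i j : arm_at_spec i j (arm_at i j).
Proof.
rewrite /arm_at; case: insubP => [u hj <-|] /=; first exact: ArmAtSome.
by rewrite -leqNgt; apply: ArmAtNone.
Qed.

Lemma arm_at_self (a : arm) : arm_at (tag a) (tagged a) = Some a.
Proof.
case: arm_atP => [b h1 h2 _|]; last by rewrite leqNgt ltn_ord.
by congr Some; apply/eqP; rewrite arm_eq; apply/andP; split; apply/eqP.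
Qed.

Lemma arm_tgtE (a : arm) : tgt (a : arrow Q) =
  if tagged a == 0%N :> nat then None else arm_at (tag a) (tagged a).-1.
Proof. by rewrite /= /star_vertex /arm_at; case: (tagged a) => [[|l] hl]. Qed.

Lemma arm_tgt_center (a : arm) :
  (tgt (a : arrow Q) == None) = (tagged a == 0%N :> nat).
Proof.
rewrite arm_tgtE; case: (tagged a =P 0%N :> nat) => // h.
case: arm_atP => [b _ _ _|] //=.
by have := ltn_ord (tagged a); lia.
Qed.

(** Besides b^*, the only arrow of the double with target b is the next one on
the same arm. *)
Lemma arm_tgt_arm (a b : arm) : (tgt (a : arrow Q) == Some b)
  = (tag a == tag b) && (tagged a == (tagged b).+1 :> nat).
Proof.
rewrite arm_tgtE; case: (tagged a =P 0%N :> nat) => [->|h]; first by rewrite andbF.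
case: arm_atP => [c h1 h2 _|]; last by have := ltn_ord (tagged a); lia.
rewrite [LHS](arm_eq c b); congr (_ && _); first by rewrite h1.
by rewrite h2; lia.
Qed.

Lemma pairwise_pmap (T1 T2 : Type) (r1 : rel T1) (r2 : rel T2)
    (g : T1 -> option T2) e :
  (forall x y x' y', r1 x y -> g x = Some x' -> g y = Some y' -> r2 x' y') ->
  pairwise r1 e -> pairwise r2 (pmap g e).
Proof.
move=> hr; elim: e => //= x e IH /andP[hx /IH he].
case gx: (g x) => [x'|] //=; rewrite he andbT.
elim: e hx {IH he} => //= y e IH /andP[xy hx].
by case gy: (g y) => [y'|] /=; rewrite ?IH // (hr _ _ _ _ xy gx gy).
Qed.

Lemma big_pmap_oapp (R : pzRingType) (T1 T2 : Type) (g : T1 -> option T2)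
    (F : T2 -> R) e :
  \prod_(y <- pmap g e) F y = \prod_(x <- e) oapp F 1 (g x).
Proof.
elim: e => [|x e IH]; first by rewrite !big_nil.
by rewrite big_cons /=; case: (g x) => [y|] /=; rewrite ?big_cons IH ?mul1r.
Qed.

Lemma perm_pair (T : eqType) (c : seq T) x y : perm_eq c [:: x; y] ->
  c = [:: x; y] \/ c = [:: y; x].
Proof.
move=> pc; have [] := (perm_uniq pc, perm_mem pc).
move: (perm_size pc); case: c {pc} => [|u [|v [|]]] //= _ + hm.
rewrite !inE !andbT => _.
have := hm u; have := hm v; have := hm x; have := hm y; rewrite !inE !eqxx ?orbT /=.
move=> hy hx /esym/orP[]/eqP ev /esym/orP[]/eqP eu; subst u v; auto.
  by move: hy; rewrite orbb => /eqP->; left.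
by move: hx; rewrite orbb => /eqP->; left.
Qed.

Variables (s : seq (arrow D)).
Hypothesis s_order : admissible_order s.

(** At the centre, an admissible order lists the first arrows of the arms in
increasing order of the arms. *)
Lemma prod_center (R : pzRingType) (F : arrow D -> R) :
  \prod_(a <- s | tgt a == None) F a
    = \prod_(i < k) oapp (fun a => F (inl a)) 1 (arm_at i 0).
Proof.
have [us sT so] := s_order.
(* both sides list the same arrows, sorted by their position in s *)
pose g i : option (arrow D) := omap inl (arm_at i 0).
have -> : \prod_(i < k) oapp (fun a => F (inl a)) 1 (arm_at i 0)
    = \prod_(a <- pmap g (enum 'I_k)) F a.
  rewrite big_pmap_oapp enumT [index_enum _]unlock; apply: eq_bigr => i _.
  by rewrite /g; case: (arm_at i 0).
pose lt (a b : arrow D) := (index a s < index b s)%N.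
have lt_tr : transitive lt by move=> a b c; apply: ltn_trans.
rewrite -big_filter; congr (bigop _ _ _).
apply: (@irr_sorted_eq _ lt) => //.
- by move=> a; rewrite /lt ltnn.
- apply: sorted_filter => //; case es: s => [|a0 s'] //; rewrite -es.
  apply/(sortedP a0) => i hi; rewrite /lt !index_uniq //.
  exact: ltnW.
- rewrite sorted_pairwise //.
  apply: (@pairwise_pmap _ _ (fun i j : 'I_k => (i < j)%N)).
    move=> i j a b ij; rewrite /g.
    case: arm_atP => //= a' ai a0 _ [<-]; case: arm_atP => //= b' bj b0 _ [<-].
    by apply: so => //; rewrite ai bj.
  rewrite -sorted_pairwise; last by move=> a b c; apply: ltn_trans.
  by have := iota_ltn_sorted 0 k; rewrite -val_enum_ord sorted_map.
move=> a; rewrite mem_filter sT andbT mem_pmap.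
case: a => a; last first.
  rewrite /= ; apply/esym/negbTE/mapP => -[i _]; rewrite /g.
  by case: (arm_at i 0).
rewrite [LHS](arm_tgt_center a); apply/eqP/mapP => [a0|[i _]].
  by exists (tag a); rewrite ?mem_enum // /g -a0 arm_at_self.
by rewrite /g; case: arm_atP => // b _ b0 _ [->].
Qed.

(** At a noncentral vertex b, only b^* and the next arrow of the arm, if there is
one, contribute to the product; their order is not specified. *)
Lemma prod_arm (R : pzRingType) (F : arrow D -> R) (b : arm) :
  let P := \prod_(a <- s | tgt a == Some b) F a in
  let F' := oapp (fun a => F (inl a)) 1 (arm_at (tag b) (tagged b).+1) in
  P = F (inr b) * F' \/ P = F' * F (inr b).
Proof.
have [us sT _] := s_order; move=> P F'; rewrite {}/P {}/F' -big_filter.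
set c : seq (arrow D) := filter _ _.
have uc : uniq c by exact: filter_uniq.
have memc (a : arrow D) : (a \in c) = (tgt a == Some b).
  by rewrite mem_filter sT andbT.
case: arm_atP => [a h1 h2 _|hb] /=.
  have : perm_eq c [:: inl a; inr b].
    apply: uniq_perm => // -[x|x]; rewrite memc !inE.
      rewrite [LHS](arm_tgt_arm x b) orbF [RHS](arm_eq x a).
      by congr (_ && _); rewrite ?h1 ?h2.
    by rewrite /=; apply/eqP/eqP => [[->]|[->]].
  move/perm_pair.
  by case=> ->; rewrite !big_cons !big_nil mulr1; [right|left].
have -> : c = [:: inr b].
  apply/perm_small_eq => //; apply: uniq_perm => // -[x|x]; rewrite memc !inE.
    rewrite [LHS](arm_tgt_arm x b) /=; apply/negbTE/negP => /andP[/eqP e /eqP h].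
    by have := ltn_ord (tagged x); rewrite h e; lia.
  by rewrite /=; apply/eqP/eqP => [[->]|[->]].
by rewrite big_seq1 mulr1; left.
Qed.

End StarOrder.

(** * The map from the star algebra onto the corner *)

Lemma prod_kconst (K : fieldType) (B : kalg K) (I : Type) (r : seq I)
    (c : I -> K) (y : I -> B) :
  \prod_(i <- r) (kconst B (c i) * y i)
    = kconst B (\prod_(i <- r) c i) * \prod_(i <- r) y i.
Proof.
elim: r => [|i r IH]; first by rewrite !big_nil rmorph1 mul1r.
rewrite !big_cons IH rmorphM -!mulrA; congr (_ * _).
by rewrite !mulrA kconst_central.
Qed.

(** The unit of the corner is e, hence the extra factor e in the product. *)
Lemma corner_val_prod (K : fieldType) (B : kalg K) (e : B) (ee : e * e = e)
    (I : Type) (r : seq I) (f : I -> corner_alg ee) (g : I -> B) :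
  (forall i, val (f i) = e * g i) -> (forall i, e * g i = g i * e) ->
  val (\prod_(i <- r) f i) = e * \prod_(i <- r) g i.
Proof.
move=> fg eg; elim: r => [|i r IH]; first by rewrite !big_nil mulr1.
rewrite !big_cons; apply: etrans (congr2 *%R (fg i) IH) _.
by rewrite mulrA -[e * g i * e]mulrA -eg !mulrA ee.
Qed.

Lemma star_vertexS (k : nat) (w : 'I_k -> nat) i j :
  star_vertex w i j.+1 = arm_at w i j.
Proof. by []. Qed.

(** A root of a split polynomial with nonzero constant term is invertible. *)
Lemma linear_prod_unit (K : fieldType) (A : kalg K) (x : A) (I : Type)
    (r : seq I) (c : I -> K) :
  \prod_(j <- r) c j != 0 -> \prod_(j <- r) (x - kconst A (c j)) = 0 ->
  exists y, x * y = 1 /\ y * x = 1.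
Proof.
have cc c' z : kconst A c' * z = z * kconst A c' by exact: kconst_central.
(* expand the product: its constant term is prod (- c j), and the rest is
   divisible by x *)
have [z [xz ->]] : exists z, x * z = z * x /\
    \prod_(j <- r) (x - kconst A (c j)) = x * z + kconst A (\prod_(j <- r) - c j).
  elim: r => [|j r [z [xz hz]]].
    by exists 0; rewrite !big_nil mulr0 mul0r add0r rmorph1.
  exists (x * z + kconst A (\prod_(j <- r) - c j) - kconst A (c j) * z); split.
    rewrite !mulrDr !mulrDl mulrN mulNr -!cc -[x * z * x]mulrA -xz.
    by rewrite -[_ * z * x]mulrA -xz !mulrA -cc.
  rewrite !big_cons hz [in RHS]rmorphM rmorphN mulrBl [in RHS]mulrBr mulNr.
  rewrite [kconst A (c j) * (_ + _)]mulrDr [kconst A (c j) * (x * z)]mulrA.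
  by rewrite [kconst A (c j) * x]cc -[x * _ * z]mulrA opprD addrA.
move=> c0; set u := \prod_(j <- r) - c j.
have un : u != 0.
  move: c0; rewrite /u; elim: r {z xz u} => [|j r IH]; first by rewrite !big_nil.
  by rewrite !big_cons !mulf_eq0 oppr_eq0 !negb_or => /andP[-> /IH].
move=> /eqP; rewrite addr_eq0 => /eqP e.
exists (- (kconst A u^-1 * z)); split.
  by rewrite mulrN mulrA -cc -mulrA e mulrN opprK -rmorphM mulVf ?rmorph1.
by rewrite mulNr -mulrA -xz e mulrN opprK -rmorphM mulVf ?rmorph1.
Qed.

Lemma scaled_left_unit (K : fieldType) (A : kalg K) (x y : A) c :
  y * x = 1 -> c != 0 -> exists b, b * (kconst A c * x) = 1.
Proof.
move=> yx cn; exists (y * kconst A c^-1).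
by rewrite -mulrA [X in y * X]mulrA -rmorphM mulVf // rmorph1 mul1r.
Qed.

(** The generator x_i of the star algebra. *)
Definition star_gen (K : fieldType) (k : nat) (w : 'I_k -> nat)
    (xi : 'I_k -> nat -> K) (i : 'I_k) : star_alg w xi :=
  quot_proj (star_relation w xi) (free_gen K i).

(** Here B is any algebra with a representation satisfying, vertex by vertex,
the relations of the multiplicative preprojective algebra of the star. *)
Section StarRep.
Variables (K : fieldType) (k : nat) (w : 'I_k -> nat) (xi : 'I_k -> nat -> K).
Hypothesis w_gt0 : forall i : 'I_k, (0 < w i)%N.
Hypothesis xi_neq0 : forall (i : 'I_k) (j : nat), (1 <= j <= w i)%N -> xi i j != 0.
Local Notation Q := (star_quiver w).
Local Notation D := (double_quiver Q).
Variables (s : seq (arrow D)) (s_order : admissible_order s).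
Local Notation q := (@star_weight k w K xi).

Variables (B : kalg K) (E : vertex Q -> B) (al inv : arrow D -> B).
Hypothesis rep : mpa_loc_rep E al inv.
Hypothesis rel : forall v : vertex Q,
  E v * \prod_(a <- s | tgt a == v) rep_factor al inv a = kconst B (q v) * E v.

Local Notation kc := (kconst B).
Local Notation E0 := (E (None : vertex Q)).

(** The image of the arrow [i, j.+1] -> [i, j], or 0 if there is no such arrow. *)
Definition arm_in i j : B := oapp (fun a => al (inl a)) 0 (arm_at w i j).
(** The image of the reverse arrow [i, j] -> [i, j.+1], or 0. *)
Definition arm_out i j : B := oapp (fun a => al (inr a)) 0 (arm_at w i j).
(** The element X_ij, up to multiplication by the idempotent at [i, j]: it is
not cut down to that vertex, but the other vertices only see a scalar. *)
Definition arm_gen i j : B := kc (xi i j.+1) * (1 + arm_in i j * arm_out i j).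

Lemma arm_in_src i j : arm_in i j * E (star_vertex w i j.+1) = arm_in i j.
Proof.
rewrite /arm_in star_vertexS.
case: arm_atP => [a _ _ _|_] /=; last by rewrite mul0r.
exact: (rep_src rep (inl a)).
Qed.

Lemma oapp_gunit i j :
  oapp (fun a => rep_factor al inv (inl a)) 1 (arm_at w i j)
    = 1 + arm_in i j * arm_out i j.
Proof.
by rewrite /arm_in /arm_out; case: (arm_at w i j) => [a|] //=; rewrite mulr0 addr0.
Qed.

Lemma vertex_gunit i j v :
  E v * (1 + arm_in i j * arm_out i j) = (1 + arm_in i j * arm_out i j) * E v.
Proof.
rewrite /arm_in /arm_out; case: (arm_at w i j) => [a|] /=.
  exact: (rep_vertex_gunit rep (inl a)).
by rewrite mulr0 addr0 mulr1 mul1r.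
Qed.

Lemma arm_gen_vertex i j v : E v * arm_gen i j = arm_gen i j * E v.
Proof. by rewrite /arm_gen mulrA -kconst_central -!mulrA vertex_gunit. Qed.

Lemma arm_gen_gunit i j : (j < w i)%N ->
  1 + arm_in i j * arm_out i j = kc (xi i j.+1)^-1 * arm_gen i j.
Proof.
move=> hj; have h := xi_neq0 (i := i) (j := j.+1) hj.
by rewrite /arm_gen mulrA -rmorphM mulVf // rmorph1 mul1r.
Qed.

(** The relation at the vertex b = [i, j.+1], as an equality of two expressions
for X_{i,j+1} there. *)
Lemma rel_arm i j b : arm_at w i j = Some b ->
  E (Some b) * arm_gen i j.+1
    = kc (xi i j.+1) * (E (Some b) * (1 + arm_out i j * arm_in i j)).
Proof.
move=> hb; have := rel (Some b); have := prod_arm s_order (rep_factor al inv) b.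
have [_ _ _ hV Vh] := rep; have := hV (inr b); have := Vh (inr b).
have Vc := rep_vertex_inv rep (inr b) (Some b).
have Hc := rep_vertex_gunit rep (inr b) (Some b).
move: hb Vc Hc; case: arm_atP => // a ai aj hj [ab]; subst a.
rewrite -[rev_arrow _]/(inl b) => Vc Hc iH Hi.
have -> : arm_out i j = al (inr b) by rewrite /arm_out -ai -aj arm_at_self.
have -> : arm_in i j = al (inl b) by rewrite /arm_in -ai -aj arm_at_self.
cbv zeta; rewrite aj ai oapp_gunit.
change (rep_factor al inv (inr b)) with (inv (inr b)).
have qb : q (Some b) = xi i j.+1 / xi i j.+2 by rewrite -ai -aj /=; case: (b).
rewrite qb; set H := 1 + al (inr b) * al (inl b) in Hc iH Hi *.
set G := 1 + arm_in i j.+1 * arm_out i j.+1.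
have hx : xi i j.+2 != 0 by apply: xi_neq0; lia.
move=> hP hr.
have EG : E (Some b) * G = kc (xi i j.+1 / xi i j.+2) * (E (Some b) * H).
  (* the two factors at this vertex may come in either order *)
  case: hP hr => -> hr.
    rewrite Hc [RHS]mulrA kconst_central -mulrA -hr mulrA -Hc -[RHS]mulrA.
    by rewrite [H * _]mulrA Hi mul1r.
  by rewrite [RHS]mulrA -hr -!mulrA iH mulr1.
rewrite /arm_gen -/G mulrA -kconst_central -mulrA EG mulrA -rmorphM.
by rewrite mulrCA mulfV // mulr1.
Qed.

Lemma arm_gen_in i j : arm_gen i j * arm_in i j = arm_in i j * arm_gen i j.+1.
Proof.
case hb: (arm_at w i j) => [b|]; last by rewrite /arm_in hb mulr0 mul0r.
have := rel_arm hb; rewrite -[Some b]hb -star_vertexS => hr.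
rewrite -[in RHS]arm_in_src -[RHS]mulrA hr.
rewrite mulrA -kconst_central -mulrA [_ * (E _ * _)]mulrA arm_in_src.
by rewrite /arm_gen -mulrA; congr (_ * _); rewrite mulrDl mul1r mulrDr mulr1 mulrA.
Qed.

(** The path [i, j] -> 0 along the arm i. *)
Fixpoint down_path i j : B :=
  if j is j'.+1 then down_path i j' * arm_in i j' else E0.
(** The reverse path 0 -> [i, j]. *)
Fixpoint up_path i j : B :=
  if j is j'.+1 then arm_out i j' * up_path i j' else E0.

Lemma down_src i j : down_path i j * E (star_vertex w i j) = down_path i j.
Proof.
case: j => [|j] /=; first exact: (vs_idem (rep_vertices rep)).
by rewrite -mulrA arm_in_src.
Qed.

Lemma down_tgt i j : E0 * down_path i j = down_path i j.
Proof.
elim: j => [|j IH] /=; first exact: (vs_idem (rep_vertices rep)).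
by rewrite mulrA IH.
Qed.

Lemma arm_gen_down i j : arm_gen i 0 * down_path i j = down_path i j * arm_gen i j.
Proof.
elim: j => [|j IH] /=; first by rewrite arm_gen_vertex.
by rewrite mulrA IH -mulrA arm_gen_in mulrA.
Qed.

(** The constant c is the product of the xi_il for l <= m; its value is not
needed. *)
Lemma arm_gen_poly_path i m : (m <= w i)%N ->
  exists c, \prod_(1 <= j < m.+1) (arm_gen i 0 - kc (xi i j)) * E0
    = kc c * (down_path i m * up_path i m).
Proof.
elim: m => [|m IH] hm.
  exists 1; rewrite big_geq // rmorph1 !mul1r /=.
  by rewrite (vs_idem (rep_vertices rep)).
have [c hc] := IH (ltnW hm); exists (c * xi i m.+1).
have comm : GRing.comm (arm_gen i 0 - kc (xi i m.+1))
    (\prod_(1 <= j < m.+1) (arm_gen i 0 - kc (xi i j))).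
  have cc c' x : GRing.comm x (kc c') by apply/esym; exact: kconst_central.
  by apply: commr_prod => j _; apply: commrB => //; apply/commr_sym; exact: commrB.
rewrite big_nat_recr //= -comm -mulrA hc.
have key : (arm_gen i 0 - kc (xi i m.+1)) * down_path i m
    = kc (xi i m.+1) * (down_path i m * (arm_in i m * arm_out i m)).
  rewrite mulrBl arm_gen_down (kconst_central (xi i m.+1) (down_path i m)) -mulrBr.
  have -> : arm_gen i m - kc (xi i m.+1)
      = kc (xi i m.+1) * (arm_in i m * arm_out i m).
    by rewrite /arm_gen mulrDr mulr1 addrAC subrr add0r.
  by rewrite mulrA -kconst_central -mulrA.
rewrite [LHS]mulrA -kconst_central rmorphM -!mulrA; congr (_ * _).
by rewrite [LHS]mulrA key !mulrA.
Qed.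

Lemma arm_gen_poly i :
  E0 * \prod_(1 <= j < (w i).+1) (arm_gen i 0 - kc (xi i j)) = 0.
Proof.
have [c hc] := arm_gen_poly_path (leqnn (w i)).
have -> : E0 * \prod_(1 <= j < (w i).+1) (arm_gen i 0 - kc (xi i j))
    = \prod_(1 <= j < (w i).+1) (arm_gen i 0 - kc (xi i j)) * E0.
  apply: commr_prod => j _; rewrite /GRing.comm mulrBr mulrBl arm_gen_vertex.
  by rewrite kconst_central.
(* down_path i (w i) ends with the missing arrow, which is 0 *)
rewrite hc; move: (w_gt0 i); case ew: (w i) => [|m] // _.
rewrite /= /arm_in; case: arm_atP => [a _ _|_] /=; first by rewrite ew ltnn.
by rewrite mulr0 mul0r mulr0.
Qed.

Lemma arm_gen_prod : E0 * \prod_(i < k) arm_gen i 0 = E0.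
Proof.
have := rel (None : vertex Q).
rewrite (prod_center s_order).
rewrite (eq_bigr (fun i => 1 + arm_in i 0 * arm_out i 0)); last first.
  by move=> i _; rewrite oapp_gunit.
rewrite /arm_gen prod_kconst mulrA -kconst_central -mulrA => ->.
rewrite mulrA -rmorphM /= -big_split /= big1 ?rmorph1 ?mul1r // => i _.
by rewrite mulfV // xi_neq0 //= w_gt0.
Qed.

Variable ee : E0 * E0 = E0.

Lemma star_to_corner : exists h : khom (star_alg w xi) (corner_alg ee),
  forall i, val (h (star_gen w xi i)) = E0 * arm_gen i 0.
Proof.
have cX i : corner_pred E0 (E0 * arm_gen i 0).
  rewrite /corner_pred; apply/eqP.
  by rewrite mulrA ee -mulrA -arm_gen_vertex mulrA ee.
pose f i : corner_alg ee := Sub (E0 * arm_gen i 0) (cX i).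
have [g gE] := free_lift f.
have [|h hE] := @quot_lift K _ _ (star_relation w xi) g.
  move=> _ [|i].
    rewrite rmorphB rmorph1 rmorph_prod; apply/eqP; rewrite subr_eq0; apply/eqP.
    apply/val_inj.
    rewrite (@corner_val_prod _ _ _ ee _ _ _ (fun i => arm_gen i 0)).
    - exact: arm_gen_prod.
    - by move=> i; rewrite gE.
    - by move=> i; rewrite arm_gen_vertex.
  rewrite rmorph_prod; apply/val_inj.
  rewrite (@corner_val_prod _ _ _ ee _ _ _ (fun j => arm_gen i 0 - kc (xi i j))).
  - exact: arm_gen_poly.
  - move=> j; rewrite rmorphB khomC gE mulrBr -kconst_central //.
  - by move=> j; rewrite mulrBr mulrBl arm_gen_vertex kconst_central.
by exists h => i; rewrite hE gE.
Qed.

Variable h : khom (star_alg w xi) (corner_alg ee).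
Local Notation A := (star_alg w xi).
Hypothesis hE : forall i, val (h (star_gen w xi i)) = E0 * arm_gen i 0.
Hypothesis gen : forall T : B -> Prop, subalgebra T -> (forall v, T (E v)) ->
  (forall a, T (al a)) -> (forall a, T (inv a)) -> forall x, T x.

Lemma star_gen_root i :
  \prod_(1 <= j < (w i).+1) (star_gen w xi i - kconst (star_alg w xi) (xi i j)) = 0.
Proof.
rewrite /star_gen -(quot_proj0 (StarRelPoly w xi i)) rmorph_prod.
by apply: eq_bigr => j _; rewrite rmorphB.
Qed.

Lemma star_gen_unit i :
  exists y : star_alg w xi, star_gen w xi i * y = 1 /\ y * star_gen w xi i = 1.
Proof.
apply: (@linear_prod_unit _ (star_alg w xi) _ _ (index_iota 1 (w i).+1) (xi i)).
  rewrite prodf_seq_neq0; apply/allP => j; rewrite mem_index_iota => /andP[j1 jw].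
  by apply: xi_neq0; rewrite j1 -ltnS.
exact: star_gen_root.
Qed.

(** The path from the vertex v to the centre. *)
Definition down_to (v : vertex Q) : B :=
  if v is Some b then down_path (tag b) (tagged b).+1 else E0.

Lemma down_to_vertex i j : (j <= (w i).-1)%N ->
  down_to (star_vertex w i j) = down_path i j.
Proof.
case: j => // j hj; rewrite star_vertexS; case: arm_atP => [a <- <- _ //|].
by rewrite leqNgt hj.
Qed.

Lemma down_to_src v : down_to v * E v = down_to v.
Proof.
case: v => [a|] /=; last exact: ee.
by have := down_src (tag a) (tagged a).+1; rewrite star_vertexS arm_at_self.
Qed.

Lemma down_to_tgt v : E0 * down_to v = down_to v.
Proof.
by case: v => [a|] /=; [exact: (down_tgt (tag a) (tagged a).+1)|exact: ee].
Qed.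

(** Membership in the sum over v of f(A) p_v, a left f(A)-submodule of B. *)
Definition spanned (y : B) : Prop := exists c : vertex Q -> star_alg w xi,
  y = \sum_v val (h (c v)) * down_to v.

Lemma val_hD a b : val (h (a + b)) = val (h a) + val (h b).
Proof. by rewrite rmorphD. Qed.
Lemma val_hM a b : val (h (a * b)) = val (h a) * val (h b).
Proof. by rewrite rmorphM. Qed.
Lemma val_h0 : val (h 0) = 0.
Proof. by rewrite rmorph0. Qed.
Lemma val_h1 : val (h 1) = E0.
Proof. by rewrite rmorph1. Qed.
Lemma val_hC c : val (h (kconst (star_alg w xi) c)) = kc c * E0.
Proof. by rewrite khomC. Qed.

Lemma spannedD y z : spanned y -> spanned z -> spanned (y + z).
Proof.
move=> [c ->] [d ->]; exists (fun v => c v + d v); rewrite -big_split.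
by apply: eq_bigr => v _; rewrite val_hD mulrDl.
Qed.

Lemma spannedM a y : spanned y -> spanned (val (h a) * y).
Proof.
move=> [c ->]; exists (fun v => a * c v); rewrite mulr_sumr.
by apply: eq_bigr => v _; rewrite val_hM mulrA.
Qed.

Lemma spanned0 : spanned 0.
Proof. by exists (fun=> 0); rewrite big1 // => v _; rewrite val_h0 mul0r. Qed.

Lemma spanned_down v : spanned (down_to v).
Proof.
exists (fun u => if u == v then 1 else 0); rewrite (bigD1 v) //= eqxx big1.
  by rewrite val_h1 down_to_tgt addr0.
by move=> u /negPf->; rewrite val_h0 mul0r.
Qed.

Lemma down_to_orth u v : u != v -> down_to u * E v = 0.
Proof.
by move=> uv; rewrite -down_to_src -mulrA (vs_orth (rep_vertices rep)) ?mulr0.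
Qed.

Lemma down_gunit i j : (j < w i)%N ->
  down_path i j * (1 + arm_in i j * arm_out i j)
  = val (h (kconst A (xi i j.+1)^-1 * star_gen w xi i)) * down_path i j.
Proof.
move=> hj; rewrite arm_gen_gunit // val_hM val_hC hE.
have aux : E0 * arm_gen i 0 * down_path i j = arm_gen i 0 * down_path i j.
  by rewrite arm_gen_vertex -mulrA down_tgt.
rewrite mulrA -kconst_central -mulrA -arm_gen_down -[RHS]mulrA aux -[RHS]mulrA.
by rewrite [E0 * (_ * _)]mulrA aux.
Qed.

(** If p_v g = f(a) p_v with a left invertible and g right invertible, then
p_v times the right inverse of g stays in the span. *)
Lemma down_to_inv v g g' a : g * g' = 1 -> (exists b, b * a = 1) ->
  down_to v * g = val (h a) * down_to v -> spanned (down_to v * g').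
Proof.
move=> gg [b ba] e; have -> : down_to v * g' = val (h b) * down_to v.
  transitivity (val (h (b * a)) * down_to v * g').
    by rewrite ba val_h1 down_to_tgt.
  by rewrite val_hM -[_ * _ * down_to v]mulrA -e -!mulrA gg mulr1.
exact/spannedM/spanned_down.
Qed.

Lemma scaled_gen_unit i c : c != 0 ->
  exists b, b * (kconst A c * star_gen w xi i) = 1 :> star_alg w xi.
Proof.
by have [y [_ yx]] := star_gen_unit i; apply: scaled_left_unit yx.
Qed.

Lemma val_hB a b : val (h (a - b)) = val (h a) - val (h b).
Proof. by rewrite rmorphB. Qed.

Lemma down_to_arm (a : arm_index w) :
  down_to (tgt (inl a : arrow D)) * al (inl a) = down_to (Some a).
Proof.
rewrite -[tgt _]/(star_vertex w (tag a) (tagged a)) down_to_vertex.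
  by rewrite /= /arm_in arm_at_self.
exact/ltnW/ltn_ord.
Qed.

Lemma down_to_gunit (a : arm_index w) : down_to (tgt (inl a : arrow D))
    * (1 + al (inl a) * al (inr a))
  = val (h (kconst A (xi (tag a) (tagged a).+1)^-1 * star_gen w xi (tag a)))
    * down_to (tgt (inl a : arrow D)).
Proof.
have lt := ltn_ord (tagged a).
have := @down_gunit (tag a) (tagged a).
rewrite /arm_in /arm_out arm_at_self /=.
rewrite down_to_vertex ?(ltnW lt) // => -> //; lia.
Qed.

Lemma spanned_mul x v : spanned (down_to v * x).
Proof.
have gunit := down_to_gunit.
have invn (a : arm_index w) : (xi (tag a) (tagged a).+1)^-1 != 0.
  by rewrite invr_eq0; apply: xi_neq0; have := ltn_ord (tagged a); lia.
move: x v; apply: gen.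
- split=> [c|x y hx hy|x y hx hy] v.
  + rewrite -kconst_central -[down_to v]down_to_tgt mulrA -val_hC.
    exact/spannedM/spanned_down.
  + by rewrite mulrDr; apply: spannedD.
  + rewrite mulrA; have [c ->] := hx v; rewrite mulr_suml.
    elim/big_ind: _ => [||u _]; [exact: spanned0|exact: spannedD|].
    by rewrite -mulrA; apply: spannedM.
- move=> u v; have [<-|uv] := eqVneq v u.
    by rewrite down_to_src; apply: spanned_down.
  by rewrite down_to_orth //; apply: spanned0.
- move=> [a|a] v; rewrite -(rep_tgt rep) mulrA.
  + have [->|uv] := eqVneq v (tgt (inl a : arrow D)); last first.
      by rewrite down_to_orth // mul0r; apply: spanned0.
    rewrite down_to_src down_to_arm; exact: spanned_down.
  + have [->|uv] := eqVneq v (Some a); last first.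
      by rewrite down_to_orth // mul0r; apply: spanned0.
    rewrite down_to_src.
    have -> : down_to (Some a) * al (inr a)
      = val (h (kconst A (xi (tag a) (tagged a).+1)^-1 * star_gen w xi (tag a) - 1))
        * down_to (tgt (inl a : arrow D)).
      rewrite val_hB mulrBl -gunit val_h1 down_to_tgt mulrDr mulr1.
      rewrite addrAC subrr add0r.
      by rewrite mulrA down_to_arm.
    exact/spannedM/spanned_down.
move=> [a|a] v; rewrite -[down_to v]down_to_src -mulrA.
- have [->|uv] := eqVneq v (tgt (inl a : arrow D)); last first.
    rewrite (rep_vertex_inv1 rep) 1?eq_sym // down_to_src; exact: spanned_down.
  rewrite mulrA down_to_src.
  have [b ba] := scaled_gen_unit (tag a) (invn a).
  apply: (down_to_inv (rep_mulV rep (inl a)) (ex_intro _ b ba)).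
  exact: gunit.
have [->|uv] := eqVneq v (Some a); last first.
  rewrite (rep_vertex_inv1 rep) 1?eq_sym // down_to_src; exact: spanned_down.
rewrite mulrA down_to_src.
have [b ba] := scaled_gen_unit (tag a) (invn a).
apply: (down_to_inv (rep_mulV rep (inr a)) (ex_intro _ b ba)).
rewrite -down_to_arm mulrA -gunit -!mulrA; congr (_ * _).
by rewrite mulrDr mulrDl mulr1 mul1r mulrA.
Qed.

Lemma corner_surj (y : corner_alg ee) : exists a, h a = y.
Proof.
have [c hc] := spanned_mul (val y) (None : vertex Q).
exists (c (None : vertex Q)); apply/val_inj.
have := congr1 (fun z => z * E0) hc; rewrite /= cornerl cornerr => ->.
rewrite mulr_suml (bigD1 (None : vertex Q)) //= big1 ?addr0.
  by rewrite -mulrA ee cornerr.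
by move=> v vn; rewrite -mulrA down_to_orth ?mulr0.
Qed.

End StarRep.

(** * A matrix representation of the localized path algebra *)

Section MatrixAlgebra.
Variables (K : fieldType) (A : kalg K) (V : finType).
Local Notation M := 'M[A]_#|V|.

(** The structure map of the algebra of square matrices over A indexed by V;
a scalar matrix is central when its entry comes from K. *)
Definition mx_const (c : K) : M := (kconst A c)%:M.

Lemma mx_const_zmod_morphism : zmod_morphism mx_const.
Proof. by move=> c d; rewrite /mx_const !rmorphB. Qed.
Lemma mx_const_monoid_morphism : monoid_morphism mx_const.
Proof.
by split=> [|c d]; rewrite /mx_const ?rmorph1 // rmorphM; exact: scalar_mxM.
Qed.
HB.instance Definition _ := GRing.isZmodMorphism.Build K M mx_const
  mx_const_zmod_morphism.
HB.instance Definition _ := GRing.isMonoidMorphism.Build K M mx_const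
  mx_const_monoid_morphism.

Lemma mx_constM_entry c (x : M) i j : (mx_const c * x) i j = kconst A c * x i j.
Proof.
rewrite mxE (bigD1 i) //= big1 => [|l li]; rewrite mxE ?eqxx ?addr0 //.
by rewrite eq_sym (negPf li) mul0r.
Qed.

Lemma mx_const_central c (x : M) : mx_const c * x = x * mx_const c.
Proof.
apply/matrixP => i j; rewrite mx_constM_entry.
rewrite mxE (bigD1 j) //= big1 => [|l lj]; rewrite mxE ?eqxx ?addr0.
  by rewrite kconst_central.
by rewrite (negPf lj) mulr0.
Qed.

Definition mx_alg : kalg K := @KAlg K M mx_const mx_const_central.

(** The matrix with entry a in position (v, u) and 0 elsewhere; it maps the
component u to the component v. *)
Definition mx_single (v u : V) (a : A) : mx_alg :=
  \matrix_(i, j) (if (i == enum_rank v) && (j == enum_rank u) then a else 0).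

Lemma mx_singleM v u v' u' a b : mx_single v u a * mx_single v' u' b
  = if u == v' then mx_single v u' (a * b) else 0.
Proof.
apply/matrixP => i j; rewrite mxE (bigD1 (enum_rank u)) //= big1 => [|l lu].
  rewrite addr0 !mxE eqxx andbT (inj_eq enum_rank_inj).
  case: (u == v'); rewrite ?mxE /=; last by rewrite mulr0.
  by case: (i == _) => /=; [case: (j == _); rewrite ?mulr0|rewrite mul0r].
by rewrite !mxE (negPf lu) andbF mul0r.
Qed.

Lemma mx_singleD v u a b : mx_single v u (a + b) = mx_single v u a + mx_single v u b.
Proof. by apply/matrixP => i j; rewrite !mxE; case: ifP => // _; rewrite addr0. Qed.

Lemma mx_single0 v u : mx_single v u 0 = 0.
Proof. by apply/matrixP => i j; rewrite !mxE; case: ifP. Qed.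

Lemma mx_singleZ c v u a :
  kconst mx_alg c * mx_single v u a = mx_single v u (kconst A c * a).
Proof.
apply/matrixP => i j; apply: etrans (mx_constM_entry c _ i j) _.
by rewrite !mxE; case: ifP => // _; rewrite mulr0.
Qed.

Lemma mx_single_inj v u : injective (mx_single v u).
Proof.
by move=> a b /matrixP/(_ (enum_rank v) (enum_rank u)); rewrite !mxE !eqxx.
Qed.

Lemma mx_vertex_system : vertex_system (fun v => mx_single v v 1).
Proof.
split=> [v|u v uv|]; rewrite ?mx_singleM ?eqxx ?mulr1 // ?(negPf uv) //.
apply/matrixP => i j; rewrite summxE (bigD1 (enum_val i)) //= big1.
  by rewrite addr0 !mxE enum_valK eqxx /= eq_sym; case: eqP.
move=> v vi; rewrite mxE; case: eqP => //= iv; case/eqP: vi.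
by rewrite iv enum_rankK.
Qed.

(* the matrix acting as z at v and trivially elsewhere *)
(** The diagonal matrix with entry z at v and 1 elsewhere. *)
Definition mx_at v (z : A) : mx_alg := 1 + mx_single v v (z - 1).

Lemma mx_atM v z z' : mx_at v z * mx_at v z' = mx_at v (z * z').
Proof.
rewrite /mx_at mulrDl mul1r mulrDr mulr1 mx_singleM eqxx -addrA; congr (_ + _).
rewrite -!mx_singleD; congr mx_single.
have -> : z - 1 + (z - 1) * (z' - 1) = (z - 1) * (1 + (z' - 1)).
  by rewrite [RHS]mulrDr mulr1.
by rewrite [1 + _]addrC subrK mulrBl mul1r addrC addrA subrK.
Qed.

Lemma mx_at1 v : mx_at v 1 = 1.
Proof. by rewrite /mx_at subrr mx_single0 addr0. Qed.

Lemma mx_single_at v z z' : mx_single v v z * mx_at v z' = mx_single v v (z * z').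
Proof.
rewrite /mx_at mulrDr mulr1 mx_singleM eqxx -mx_singleD; congr mx_single.
by rewrite mulrBr mulr1 addrC subrK.
Qed.

End MatrixAlgebra.

Lemma khom_arm_gen (K : fieldType) k w xi (B C : kalg K) (h : khom B C) al i j :
  h (@arm_gen K k w xi B al i j) = arm_gen xi (h \o al) i j.
Proof.
rewrite /arm_gen /arm_in /arm_out rmorphM khomC rmorphD rmorph1 rmorphM.
by case: (arm_at w i j) => [a|] //=; rewrite !rmorph0.
Qed.

(** Here A is any algebra with elements x i satisfying the relations of the star
algebra, and y i is the inverse of x i. *)
Section StarMatrix.
Variables (K : fieldType) (k : nat) (w : 'I_k -> nat) (xi : 'I_k -> nat -> K).
Hypothesis w_gt0 : forall i : 'I_k, (0 < w i)%N.
Hypothesis xi_neq0 : forall (i : 'I_k) (j : nat), (1 <= j <= w i)%N -> xi i j != 0.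
Local Notation Q := (star_quiver w).
Local Notation D := (double_quiver Q).
Variables (s : seq (arrow D)) (s_order : admissible_order s).
Local Notation q := (@star_weight k w K xi).
Variables (A : kalg K) (x y : 'I_k -> A).
Hypothesis xy : forall i, x i * y i = 1.
Hypothesis yx : forall i, y i * x i = 1.
Hypothesis x_prod : \prod_i x i = 1.
Hypothesis x_poly : forall i,
  \prod_(1 <= j < (w i).+1) (x i - kconst A (xi i j)) = 0.

Local Notation M := (mx_alg A (vertex Q)).
Local Notation sg v u a := (@mx_single K A (vertex Q) v u a).
Local Notation kA := (kconst A).

(** For the arrow a = a_ij, arm_xi, arm_x and arm_y are xi_ij, xi_ij^-1 x_i and
xi_ij x_i^-1. *)
Definition arm_xi (a : arm_index w) : K := xi (tag a) (tagged a).+1.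
Definition arm_x (a : arm_index w) : A := kA (arm_xi a)^-1 * x (tag a).
Definition arm_y (a : arm_index w) : A := kA (arm_xi a) * y (tag a).

Definition mx_vertex (v : vertex Q) : M := sg v v 1.
(** The matrices of a_ij (an inclusion) and of a_ij^* . *)
Definition mx_arrow (b : arrow D) : M :=
  match b with
  | inl a => sg (tgt (a : arrow Q)) (Some a) 1
  | inr a => sg (Some a) (tgt (a : arrow Q)) (arm_x a - 1)
  end.
Definition mx_inv (b : arrow D) : M :=
  mx_at (tgt b : vertex Q) (match b with inl a | inr a => arm_y a end).

Lemma arm_xi_neq0 a : arm_xi a != 0.
Proof. by apply: xi_neq0; have := ltn_ord (tagged a); lia. Qed.

Lemma arm_xy a : arm_x a * arm_y a = 1.
Proof.
rewrite /arm_x /arm_y -mulrA [x _ * _]mulrA -kconst_central -!mulrA xy mulr1.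
by rewrite -rmorphM mulVf ?arm_xi_neq0 // rmorph1.
Qed.
Lemma arm_yx a : arm_y a * arm_x a = 1.
Proof.
rewrite /arm_x /arm_y -mulrA [y _ * _]mulrA -kconst_central -!mulrA yx mulr1.
by rewrite -rmorphM mulfV ?arm_xi_neq0 // rmorph1.
Qed.

Lemma mx_gunit b : 1 + mx_arrow b * mx_arrow (rev_arrow b)
  = mx_at (tgt b : vertex Q) (match b with inl a | inr a => arm_x a end).
Proof. by case: b => a; rewrite /mx_arrow /= mx_singleM eqxx ?mul1r ?mulr1. Qed.

Lemma mx_repP : mpa_loc_rep mx_vertex mx_arrow mx_inv.
Proof.
split.
- exact: mx_vertex_system.
- by case=> a; rewrite [LHS]mx_singleM eqxx mul1r.
- by case=> a; rewrite [LHS]mx_singleM eqxx mulr1.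
- by move=> b; rewrite mx_gunit mx_atM; case: b => a; rewrite arm_xy mx_at1.
- by move=> b; rewrite mx_gunit mx_atM; case: b => a; rewrite arm_yx mx_at1.
Qed.

(** The central component of the image of X_i0 is x_i. If w_i = 1 there is no
arrow on the arm i, and x_i is the scalar xi_i1 by its polynomial relation. *)
Lemma mx_center i : mx_vertex None * arm_gen xi mx_arrow i 0 = sg None None (x i).
Proof.
have xn : xi i 1 != 0 by rewrite xi_neq0 //= w_gt0.
rewrite /arm_gen mulrA -kconst_central -mulrA /arm_in /arm_out.
case: arm_atP => [a <- a0 _|wi] /=.
  have := mx_gunit (inl a); rewrite [rev_arrow _]/= => ->.
  have -> : tgt (inl a : arrow D) = None :> vertex Q.
    by apply/eqP; rewrite [_ == _](arm_tgt_center a) a0.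
  rewrite mx_single_at mx_singleZ mul1r /arm_x /arm_xi a0 mulrA -rmorphM.
  by rewrite mulfV ?rmorph1 ?mul1r // -a0 arm_xi_neq0.
rewrite mul0r addr0 mulr1 mx_singleZ mulr1; congr mx_single; apply/esym/eqP.
rewrite -subr_eq0; have := x_poly i; have -> : w i = 1%N by have := w_gt0 i; lia.
by rewrite big_nat1 => ->.
Qed.

Lemma mx_center_prod :
  mx_vertex None * \prod_(a <- s | tgt a == None) rep_factor mx_arrow mx_inv a
  = kconst M (q None) * mx_vertex None.
Proof.
rewrite (prod_center s_order).
rewrite (eq_bigr (fun i => 1 + arm_in mx_arrow i 0 * arm_out mx_arrow i 0));
  last by move=> i _; rewrite (oapp_gunit mx_arrow mx_inv).
have EX : mx_vertex None * \prod_(i < k) arm_gen xi mx_arrow i 0 = mx_vertex None.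
  transitivity (sg None None (\prod_(i < k) x i)); last by rewrite x_prod.
  elim: (index_enum _) => [|i r IH]; first by rewrite !big_nil mulr1.
  rewrite !big_cons mulrA mx_center.
  transitivity (sg None None (x i)
      * (mx_vertex None * \prod_(j <- r) arm_gen xi mx_arrow j 0)).
    by rewrite mulrA mx_singleM eqxx mulr1.
  by rewrite IH mx_singleM eqxx.
have qx : q None * \prod_(i < k) xi i 1 = 1.
  rewrite /= -big_split big1 // => i _; rewrite /= mulVf //.
  by rewrite xi_neq0 //= w_gt0.
rewrite -[in RHS]EX prod_kconst [mx_vertex None * (_ * _)]mulrA.
by rewrite -kconst_central -mulrA [RHS]mulrA -rmorphM qx rmorph1 mul1r.
Qed.

Definition root_poly i j : A := \prod_(1 <= l < j.+1) (x i - kA (xi i l)).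

(** The element m_v generating the right ideal attached to the vertex v. *)
Definition arm_poly (v : vertex Q) : A :=
  if v is Some b then root_poly (tag b) (tagged b).+1 else 1.

Lemma root_polyS i j : root_poly i j.+1 = root_poly i j * (x i - kA (xi i j.+1)).
Proof. by rewrite /root_poly big_nat_recr. Qed.

Lemma root_poly_comm i j : GRing.comm (x i) (root_poly i j).
Proof.
apply: commr_prod => l _; apply: commrB => //.
by apply/esym; exact: kconst_central.
Qed.

Lemma arm_poly_tgt (a : arm_index w) :
  arm_poly (tgt (a : arrow Q)) = root_poly (tag a) (tagged a).
Proof.
rewrite arm_tgtE; case: (tagged a =P 0%N :> nat) => [->|a0].
  by rewrite /root_poly big_geq.
case: arm_atP => [b bi bj _|]; last by have := ltn_ord (tagged a); lia.
by rewrite /arm_poly bj bi prednK // lt0n; apply/eqP.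
Qed.

Lemma arm_polyS (a : arm_index w) :
  arm_poly (Some a) = arm_poly (tgt (a : arrow Q)) * (x (tag a) - kA (arm_xi a)).
Proof. by rewrite arm_poly_tgt [LHS]root_polyS. Qed.

Lemma arm_poly_comm (a : arm_index w) v : v = Some a \/ v = tgt (a : arrow Q) ->
  x (tag a) * arm_poly v = arm_poly v * x (tag a).
Proof. by case=> ->; rewrite ?arm_poly_tgt; apply: root_poly_comm. Qed.

Lemma arm_y_comm (a : arm_index w) v : v = Some a \/ v = tgt (a : arrow Q) ->
  arm_y a * arm_poly v = arm_poly v * arm_y a.
Proof.
move=> hv; rewrite /arm_y [RHS]mulrA -kconst_central -!mulrA; congr (_ * _).
rewrite -[LHS]mulr1 -(xy (tag a)) mulrA -[_ * _ * x _]mulrA -arm_poly_comm //.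
by rewrite mulrA yx mul1r.
Qed.

(** The row v of the matrix u consists of elements of the right ideal m_v A. *)
Definition in_arms (u : M) : Prop :=
  forall v, exists z : M, mx_vertex v * u = sg v v (arm_poly v) * z.

(** The relation at a noncentral vertex, on matrices with rows in the right
ideals. The restriction to such matrices is needed at the end of an arm only,
where x_i acts as the scalar xi_{i,w_i}. *)
Lemma mx_arm_prod (b : arm_index w) u : in_arms u ->
  mx_vertex (Some b)
    * \prod_(a <- s | tgt a == Some b) rep_factor mx_arrow mx_inv a * u
  = kconst M (q (Some b)) * (mx_vertex (Some b) * u).
Proof.
move=> hu; have [z hz] := hu (Some b).
have qb : q (Some b) = arm_xi b / xi (tag b) (tagged b).+2 by rewrite /=; case: (b).
have := prod_arm s_order (rep_factor mx_arrow mx_inv) b; cbv zeta.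
have -> : rep_factor mx_arrow mx_inv (inr b)
    = mx_at (Some b : vertex Q) (arm_y b) by [].
case: arm_atP => [a ai aj _|wb].
  have -> : oapp (fun a => rep_factor mx_arrow mx_inv (inl a)) 1 (Some a)
      = mx_at (Some b : vertex Q) (arm_x a).
    rewrite /= (mx_gunit (inl a)); congr mx_at; apply/eqP.
    by rewrite [_ == _](arm_tgt_arm a b); apply/andP; split; apply/eqP.
  have xa : arm_x a = kA (xi (tag b) (tagged b).+2)^-1 * x (tag b).
    by rewrite /arm_x /arm_xi aj ai.
  have e1 : arm_x a * arm_y b = kA (q (Some b)).
    rewrite xa /arm_y -mulrA [x _ * _]mulrA -kconst_central -mulrA xy mulr1.
    by rewrite -rmorphM qb mulrC.
  have e2 : arm_y b * arm_x a = kA (q (Some b)).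
    rewrite xa /arm_y -mulrA [y _ * _]mulrA -kconst_central -mulrA yx mulr1.
    by rewrite -rmorphM qb.
  case=> ->; rewrite mx_atM mx_single_at mul1r ?e1 ?e2.
    by rewrite mulrA mx_singleZ mulr1.
  by rewrite mulrA mx_singleZ mulr1.
have -> : oapp (fun a => rep_factor mx_arrow mx_inv (inl a)) 1 None = 1 by [].
rewrite mul1r mulr1 => hP.
have -> : \prod_(a <- s | tgt a == Some b) rep_factor mx_arrow mx_inv a
    = mx_at (Some b : vertex Q) (arm_y b) by case: hP.
rewrite mx_single_at mul1r.
transitivity (sg (Some b) (Some b) (arm_y b) * (mx_vertex (Some b) * u)).
  by rewrite mulrA mx_singleM eqxx mulr1.
rewrite hz !mulrA mx_singleM eqxx mx_singleZ; congr (mx_single _ _ _ * _).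
have xb : xi (tag b) (tagged b).+2 != 0.
  by apply: xi_neq0; have := ltn_ord (tagged b); lia.
(* at the end of the arm, x_i m_v = xi_{i,w_i} m_v *)
have xm : x (tag b) * arm_poly (Some b)
    = kA (xi (tag b) (tagged b).+2) * arm_poly (Some b).
  rewrite kconst_central; apply/eqP.
  rewrite -subr_eq0 -[X in _ - X]kconst_central; apply/eqP.
  rewrite arm_poly_comm; last by left.
  rewrite kconst_central -mulrBr -[LHS]root_polyS.
  have -> : (tagged b).+2 = w (tag b) by have := ltn_ord (tagged b); lia.
  exact: x_poly.
rewrite /arm_y qb rmorphM -!mulrA; congr (_ * _).
rewrite -[in LHS](mul1r (arm_poly _)) -(rmorph1 (kconst A)) -(mulVf xb) rmorphM.
by rewrite -mulrA -xm !mulrA -kconst_central -!mulrA [y _ * _]mulrA yx mul1r.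
Qed.

Lemma in_arms_vertex0 : in_arms (mx_vertex None).
Proof.
move=> v; have [->|vn] := eqVneq v None.
  by exists (mx_vertex None); rewrite /mx_vertex !mx_singleM eqxx.
by exists 0; rewrite mulr0 mx_singleM (negPf vn).
Qed.

Variable psi : khom (mpa_loc K Q) M.
Hypothesis psiv : forall v, psi (@loc_vertex K Q v) = mx_vertex v.
Hypothesis psia : forall a, psi (@loc_arrow K Q a) = mx_arrow a.
Hypothesis psii : forall a, psi (@loc_inv K Q a) = mx_inv a.

Lemma in_armsP z u : in_arms u -> in_arms (psi z * u).
Proof.
move: z u; apply: loc_generates.
- split=> [c|z1 z2 h1 h2|z1 z2 h1 h2] u hu v.
  + have [z hz] := hu v; exists (kconst M c * z).
    by rewrite khomC mulrA -kconst_central -mulrA hz mulrA kconst_central mulrA.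
  + have [z hz] := h1 u hu v; have [z' hz'] := h2 u hu v; exists (z + z').
    by rewrite rmorphD mulrDl mulrDr hz hz' -mulrDr.
  + by rewrite rmorphM -mulrA; apply: h1; apply: h2.
- move=> v' u hu v; rewrite psiv mulrA mx_singleM; case: eqP => [<-|_].
    by rewrite mulr1; apply: hu.
  by exists 0; rewrite mul0r mulr0.
- move=> [a|a] u hu v; rewrite psia mulrA mx_singleM mul1r; case: eqP => [->|_].
  + have [z hz] := hu (Some a).
    exists (sg (tgt (a : arrow Q)) (Some a) (x (tag a) - kA (arm_xi a)) * z).
    transitivity (sg (tgt (a : arrow Q)) (Some a) 1 * (mx_vertex (Some a) * u)).
      by rewrite mulrA mx_singleM eqxx mulr1.
    by rewrite hz !mulrA !mx_singleM !eqxx mul1r arm_polyS.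
  + by exists 0; rewrite mul0r mulr0.
  + have [z hz] := hu (tgt (a : arrow Q)).
    exists (sg (Some a) (tgt (a : arrow Q)) (kA (arm_xi a)^-1) * z).
    transitivity (sg (Some a) (tgt (a : arrow Q)) (arm_x a - 1)
        * (mx_vertex (tgt (a : arrow Q)) * u)).
      by rewrite mulrA mx_singleM eqxx mulr1.
    rewrite hz !mulrA !mx_singleM !eqxx; congr (mx_single _ _ _ * _).
    have -> : arm_x a - 1 = kA (arm_xi a)^-1 * (x (tag a) - kA (arm_xi a)).
      by rewrite mulrBr -rmorphM mulVf ?arm_xi_neq0 // rmorph1.
    rewrite -mulrA kconst_central; congr (_ * _).
    rewrite arm_polyS mulrBl mulrBr arm_poly_comm; last by right.
    by rewrite kconst_central.
  + by exists 0; rewrite mul0r mulr0.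
move=> b u hu v; rewrite psii; have [z hz] := hu v.
have [vb|vb] := eqVneq v (tgt b : vertex Q); last first.
  exists z; rewrite -hz mulrA; congr (_ * _).
  by apply: (rep_vertex_inv1 mx_repP); rewrite eq_sym.
set a := match b with inl a | inr a => a end.
have va : v = Some a \/ v = tgt (a : arrow Q) by rewrite vb /a; case: (b); auto.
have -> : mx_inv b = mx_at v (arm_y a) by rewrite vb /a; case: (b).
exists (sg v v (arm_y a) * z).
rewrite mulrA mx_single_at mul1r.
transitivity (sg v v (arm_y a) * (mx_vertex v * u)).
  by rewrite mulrA mx_singleM eqxx mulr1.
by rewrite hz !mulrA !mx_singleM eqxx arm_y_comm.
Qed.

Lemma mpa_relation_killed z u : generated_ideal (mpa_relation q s) z ->
  in_arms u -> psi z * u = 0.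
Proof.
move=> hz; move: u; apply: (hz (fun z => forall u, in_arms u -> psi z * u = 0)).
  split=> [u _|z1 z2 h1 h2 u hu|a z1 b h1 u hu].
  - by rewrite rmorph0 mul0r.
  - by rewrite rmorphD mulrDl h1 ?h2 ?addr0.
  - by rewrite !rmorphM -!mulrA h1 ?mulr0 //; apply: in_armsP.
move=> _ [] u hu; rewrite rmorphB mulrBl; apply/eqP; rewrite subr_eq0; apply/eqP.
(* matrices are compared row by row *)
have sep p p' : (forall v, mx_vertex v * p = mx_vertex v * p') -> p = p'.
  move=> e; rewrite -[p]mul1r -[p']mul1r -(vs_sum (rep_vertices mx_repP)) !mulr_suml.
  by apply: eq_bigr => v _; apply: e.
apply: sep => v; rewrite loc_weightE.
have -> : psi (\prod_(a <- s) mpa_factor K a)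
    = \prod_(a <- s) rep_factor mx_arrow mx_inv a.
  rewrite rmorph_prod; apply: eq_bigr => a _; rewrite loc_factorE.
  by case: a => a; rewrite /rep_factor ?psii // rmorphD rmorph1 rmorphM !psia.
have -> : psi (\sum_v kconst (mpa_loc K Q) (q v) * loc_vertex K v)
    = \sum_v kconst M (q v) * mx_vertex v.
  by rewrite rmorph_sum; apply: eq_bigr => u' _; rewrite rmorphM khomC psiv.
rewrite !mulrA (rep_vertex_prod mx_repP).
rewrite (vertex_system_weight q v (rep_vertices mx_repP)).
case: v => [b|]; first by rewrite mx_arm_prod // mulrA.
by rewrite mx_center_prod.
Qed.

Local Notation L := (mpa q s).
Local Notation pi := (quot_proj (mpa_relation q s)).
Local Notation L0 := (mpa_vertex q s (None : vertex Q)).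
Variable LL0 : L0 * L0 = L0.
Variable h : khom A (corner_alg LL0).
Hypothesis hx : forall i, val (h (x i)) = L0 * arm_gen xi (mpa_arrow q s) i 0.
Hypothesis x_gen : forall T : A -> Prop, subalgebra T -> (forall i, T (x i)) ->
  forall a, T a.

(** The image of a in the corner lifts to an element z of the localized path
algebra acting on the central component as left multiplication by a. *)
Lemma corner_preimage a : exists z : mpa_loc K Q,
  val (h a) = pi z /\ psi z * mx_vertex None = sg None None a.
Proof.
move: a; apply: x_gen => [|i].
- split=> [c|a b [z [hz ez]] [z' [hz' ez']]|a b [z [hz ez]] [z' [hz' ez']]].
  + exists (kconst (mpa_loc K Q) c * @loc_vertex K Q None); split.
      by rewrite khomC rmorphM.
    by rewrite rmorphM khomC psiv -mulrA mx_singleM eqxx mx_singleZ !mulr1.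
  + exists (z + z'); split; first by rewrite !rmorphD [LHS]/(_ + _) hz hz'.
    by rewrite rmorphD mulrDl ez ez' mx_singleD.
  + exists (z * z'); split; first by rewrite !rmorphM [LHS]/(_ * _) hz hz'.
    rewrite rmorphM -mulrA ez'.
    transitivity (psi z * mx_vertex None * sg None None b).
      by rewrite -mulrA mx_singleM eqxx mul1r.
    by rewrite ez mx_singleM eqxx.
exists (@loc_vertex K Q None * arm_gen xi (@loc_arrow K Q) i 0); split.
  have [p pE] := quot_khom (mpa_relation q s).
  rewrite (hx i).
  have -> : mpa_arrow q s = p \o @loc_arrow K Q by apply/funext => a; rewrite /= pE.
  by rewrite -khom_arm_gen pE; exact: (esym (rmorphM pi _ _)).
rewrite rmorphM psiv khom_arm_gen.
have -> : psi \o @loc_arrow K Q = mx_arrow by apply/funext => a; rewrite /= psia.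
by rewrite mx_center mx_singleM eqxx mulr1.
Qed.

Lemma corner_inj : injective h.
Proof.
move=> a b hab; apply/eqP; rewrite -subr_eq0; apply/eqP.
have [z [hz ez]] := corner_preimage (a - b).
have hz0 : pi z = pi 0 by rewrite -hz rmorphB hab subrr rmorph0.
apply: (@mx_single_inj K A (vertex Q) None None); rewrite mx_single0 -ez.
apply: mpa_relation_killed in_arms_vertex0.
by move/quot_eqP: hz0; rewrite subr0.
Qed.

End StarMatrix.

Lemma star_generates (K : fieldType) (k : nat) (w : 'I_k -> nat)
    (xi : 'I_k -> nat -> K) (T : star_alg w xi -> Prop) : subalgebra T ->
  (forall i, T (star_gen w xi i)) -> forall a, T a.
Proof.
move=> subT Tx; apply: (quot_generates (@free_generates K _)) => //.
by move=> _ [_ [i ->] ->]; apply: Tx.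
Qed.

Theorem lemma10p1 (K : fieldType) (k : nat) (w : 'I_k -> nat)
    (xi : 'I_k -> nat -> K)
    (w_gt0 : forall i : 'I_k, (0 < w i)%N)
    (xi_neq0 : forall (i : 'I_k) (j : nat), (1 <= j <= w i)%N -> xi i j != 0)
    (s : seq (arrow (double_quiver (star_quiver w))))
    (s_order : admissible_order s) :
  kalg_iso (star_alg w xi)
    (corner_alg
       (mpa_vertex_idem (star_weight xi) s (None : vertex (star_quiver w)))).
Proof.
have rep := mpa_repP (star_weight xi) s.
have rel := mpa_vertex_prod (star_weight xi) s.
set ee := mpa_vertex_idem _ _ _.
have [h hE] := star_to_corner w_gt0 xi_neq0 s_order rep rel ee.
have h_surj := corner_surj xi_neq0 s_order rep rel hE (@mpa_generates K _ _ s).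
have [y yP] := choice (star_gen_unit xi_neq0).
have h_inj : injective h.
  have xy i := (yP i).1; have yx i := (yP i).2.
  have [psi [pv pa pi]] := loc_lift (mx_repP xi_neq0 xy yx).
  apply: (corner_inj w_gt0 xi_neq0 s_order xy yx _ _ pv pa pi hE).
  - have /quot_proj0 := StarRelProd w xi.
    rewrite rmorphB rmorph1 rmorph_prod => /eqP; rewrite subr_eq0 => /eqP e.
    exact: e.
  - exact: star_gen_root.
  - exact: star_generates.
exists h; split; last exact: khomC.
have [g gE] := choice h_surj.
by exists g => a; [apply: h_inj|]; rewrite gE.
Qed.
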